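(* Fix $0<\epsilon<1$. Assume there is $\lambda>0$ such that $\Theta(x,s)=\Lambda(x,s)/s$ satisfies $|\Theta(x,as)-\Theta(x,s)|\le\lambda|a-1|$ for all $a\in(1,2)$, $x\in\overline\Omega$, $s>0$. (1) If $u\in C(\overline\Omega)\cap W^{1,\infty}(\Omega)$ is a viscosity subsolution of $-\Delta_{\infty,\Lambda}u=0$ in $\Omega$ and $v\in C(\overline\Omega)\cap W^{1,\infty}(\Omega)$ is a viscosity supersolution of $\min\{|\nabla v|-\epsilon,\,-\Delta_{\infty,\Lambda}v\}=0$ in $\Omega$, then $$\sup_{x\in\Omega}(u-v)\le\max_{x\in\partial\Omega}(u-v).$$ (2) If $u\in C(\overline\Omega)\cap W^{1,\infty}(\Omega)$ is a viscosity supersolution of $-\Delta_{\infty,\Lambda}u=0$ in $\Omega$ and $\tilde v\in C(\overline\Omega)\cap W^{1,\infty}(\Omega)$ is a viscosity subsolution of $\max\{\epsilon-|\nabla\tilde v|,\,-\Delta_{\infty,\Lambda}\tilde v\}=0$ in $\Omega$, then $$\sup_{x\in\Omega}(\tilde v-u)\le\max_{x\in\partial\Omega}(\tilde v-u).$$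
   Context: $\Omega\subset\mathbb{R}^d$ is a bounded smooth domain, and $\Lambda\in C(\overline\Omega\times(0,\infty),\mathbb{R}^d)$ satisfies $\lim_{s\to0+}s^2\Lambda(x,s)=0$ uniformly for $x\in\overline\Omega$. Here $\Delta_\infty u=\langle D^2u\,\nabla u,\nabla u\rangle$ and $-\Delta_{\infty,\Lambda}u=-\Delta_\infty u-|\nabla u|\langle\Lambda(x,|\nabla u|),\nabla u\rangle$, where the operator is given the value $0$ when $\nabla u=0$. For an equation $G(x,\nabla u,D^2u)=0$ in $\Omega$, a viscosity subsolution (resp. supersolution) is $u\in C(\overline\Omega)$ with $G(x_0,\nabla\phi(x_0),D^2\phi(x_0))\le0$ (resp. $\ge0$) whenever $\phi\in C^2(\overline\Omega)$ and $u-\phi$ has a strict local maximum (resp. minimum) at $x_0\in\Omega$. *)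

(* Defs.v *)
From mathcomp Require Import all_boot all_order all_algebra.
From mathcomp Require Import all_classical all_reals all_analysis.

Set Implicit Arguments.
Unset Strict Implicit.
Unset Printing Implicit Defensive.

Import Order.TTheory GRing.Theory Num.Theory.
Import numFieldNormedType.Exports.

Local Open Scope classical_set_scope.
Local Open Scope ring_scope.

(* Points of R^d are row vectors 'rV[R]_d. The library norm `|x| on 'rV[R]_d is
   the sup norm, used here only through the topology and boundedness; the
   Euclidean norm is [enorm]. *)

Section Euclidean.
Variables (R : realType) (d : nat).

Definition dot (p q : 'rV[R]_d) : R := \sum_(i < d) p 0 i * q 0 i.

Definition enorm (p : 'rV[R]_d) : R := Num.sqrt (dot p p).

Definition partial (i : 'I_d) (f : 'rV[R]_d -> R) (x : 'rV[R]_d) : R :=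
  'D_(delta_mx 0 i) f x.

Definition grad (f : 'rV[R]_d -> R) (x : 'rV[R]_d) : 'rV[R]_d :=
  \row_i partial i f x.

Definition hess (f : 'rV[R]_d -> R) (x : 'rV[R]_d) : 'M[R]_d :=
  \matrix_(i, j) partial j (partial i f) x.

End Euclidean.

Section Regularity.
Variables (R : realType) (d : nat).
Implicit Types (U : set 'rV[R]_d) (f : 'rV[R]_d -> R).

(* C^k(U), for U open. *)
Fixpoint Ck (k : nat) U f : Prop :=
  (forall x, U x -> {for x, continuous f}) /\
  (if k is k'.+1 then
     forall i : 'I_d, (forall x, U x -> derivable f x (delta_mx 0 i)) /\
                      Ck k' U (partial i f)
   else True).

Definition smooth U f : Prop := forall k, Ck k U f.

(* f is C^k in the open set U, and each of its partial derivatives of order at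
   most k coincides on U with a function that is continuous on closure U. *)
Fixpoint Ck_upto (k : nat) U f : Prop :=
  (exists2 g : 'rV[R]_d -> R,
     {within closure U, continuous g} & forall x, U x -> f x = g x) /\
  (if k is k'.+1 then
     forall i : 'I_d, (forall x, U x -> derivable f x (delta_mx 0 i)) /\
                      Ck_upto k' U (partial i f)
   else True).

(* C^k(closure U). A function on closure U is represented by a function on R^d;
   its values outside closure U play no role. *)
Definition Ck_closure (k : nat) U f : Prop :=
  {within closure U, continuous f} /\ Ck_upto k U f.

End Regularity.

Section Domains.
Variables (R : realType) (d : nat).
Implicit Types (Omega : set 'rV[R]_d).

Definition frontier Omega : set 'rV[R]_d := closure Omega `\` interior Omega.

(* Near each boundary point Omega lies strictly on one side of the graph of a
   smooth function expressing one coordinate through the remaining ones: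
   [col' i x] is x with its i-th coordinate removed, and [b] is the side. *)
Definition smooth_boundary Omega : Prop :=
  forall x0, frontier Omega x0 ->
  exists (i : 'I_d) (b : bool) (gamma : 'rV[R]_d.-1 -> R) (r : R),
    [/\ 0 < r, smooth setT gamma &
        forall x, ball x0 r x ->
          (Omega x <-> 0 < (-1) ^+ b * (x 0 i - gamma (col' i x)))].

Definition bounded_smooth_domain Omega : Prop :=
  [/\ open Omega, connected Omega, Omega !=set0, bounded_set Omega &
      smooth_boundary Omega].

End Domains.

Section Sobolev.
Variable R : realType.

(* Integral over R^n with respect to n-dimensional Lebesgue measure, written as
   an iterated one-dimensional Lebesgue integral. It is applied below only to
   bounded Borel functions vanishing outside a compact set, for which the two
   agree by Fubini's theorem. *)
Fixpoint integral_rV (n : nat) : ('rV[R]_n -> R) -> \bar R :=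
  match n return ('rV[R]_n -> R) -> \bar R with
  | 0 => fun f => (f 0)%:E
  | n'.+1 => fun f =>
      (\int[@lebesgue_measure R]_t
         integral_rV (fun y : 'rV[R]_n' => f (row_mx (t%:M : 'rV[R]_1) y)))%E
  end.

Variable d : nat.
Implicit Types (Omega : set 'rV[R]_d) (f u phi : 'rV[R]_d -> R).

(* Borel measurability on R^d. *)
Definition borel_fun f : Prop :=
  forall B : set R, measurable B -> <<s @open 'rV[R]_d >> (f @^-1` B).

(* f is a bounded Borel function on Omega; every class in L^oo(Omega) contains
   such a representative. *)
Definition Linfty Omega f : Prop :=
  borel_fun (f \_ Omega) /\ exists M : R, forall x, Omega x -> `|f x| <= M.

(* C_c^oo(Omega). *)
Definition test_function Omega phi : Prop :=
  let supp := closure [set x | phi x != 0] in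
  [/\ smooth setT phi, compact supp & supp `<=` Omega].

Definition weak_partial Omega (i : 'I_d) u (g : 'rV[R]_d -> R) :
    Prop :=
  forall phi, test_function Omega phi ->
    integral_rV ((fun x => u x * partial i phi x) \_ Omega) =
    (- integral_rV ((fun x => (g x * phi x)%R) \_ Omega))%E.

Definition W1infty Omega u : Prop :=
  Linfty Omega u /\
  forall i : 'I_d, exists2 g, Linfty Omega g & weak_partial Omega i u g.

End Sobolev.

Section Viscosity.
Variables (R : realType) (d : nat).
Implicit Types (Omega : set 'rV[R]_d) (u phi w : 'rV[R]_d -> R)
  (G : 'rV[R]_d -> 'rV[R]_d -> 'M[R]_d -> R).

Definition strict_local_max w (x0 : 'rV[R]_d) : Prop :=
  \forall x \near x0^', w x < w x0.

Definition strict_local_min w (x0 : 'rV[R]_d) : Prop :=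
  \forall x \near x0^', w x0 < w x.

Definition viscosity_subsolution Omega G u : Prop :=
  {within closure Omega, continuous u} /\
  forall phi x0, Omega x0 -> Ck_closure 2 Omega phi ->
    strict_local_max (fun x => u x - phi x) x0 ->
    G x0 (grad phi x0) (hess phi x0) <= 0.

Definition viscosity_supersolution Omega G u : Prop :=
  {within closure Omega, continuous u} /\
  forall phi x0, Omega x0 -> Ck_closure 2 Omega phi ->
    strict_local_min (fun x => u x - phi x) x0 ->
    0 <= G x0 (grad phi x0) (hess phi x0).

Variable Lambda : 'rV[R]_d -> R -> 'rV[R]_d.

(* -Delta_{oo,Lambda} at (x, p, X) = (x, grad u, D^2 u); p *m X^T is the row
   vector of the matrix-vector product of X and p. *)
Definition neg_inf_laplacian (x p : 'rV[R]_d) (X : 'M[R]_d) : R :=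
  if p == 0 then 0
  else - dot (p *m X^T) p - enorm p * dot (Lambda x (enorm p)) p.

Definition min_operator (eps : R) (x p : 'rV[R]_d) (X : 'M[R]_d) : R :=
  Num.min (enorm p - eps) (neg_inf_laplacian x p X).

Definition max_operator (eps : R) (x p : 'rV[R]_d) (X : 'M[R]_d) : R :=
  Num.max (eps - enorm p) (neg_inf_laplacian x p X).

End Viscosity.

(* sup_A w <= max_B w, including that w attains its maximum on B. *)
Definition sup_le_max (R : realType) (T : Type) (A B : set T) (w : T -> R) :
    Prop :=
  exists2 m : R, (w @` B) m /\ ubound (w @` B) m &
    (ereal_sup [set (w x)%:E | x in A] <= m%:E)%E.

(* Main.v *)
Require Import Defs.
From mathcomp Require Import all_boot all_order all_algebra.
From mathcomp Require Import all_classical all_reals all_analysis.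
From mathcomp Require Import ring lra.
Import Order.TTheory GRing.Theory Num.Theory.
Import numFieldNormedType.Exports.
Local Open Scope classical_set_scope.
Local Open Scope ring_scope.
Set Implicit Arguments.
Unset Strict Implicit.
Unset Printing Implicit Defensive.

(** Divided by [- |p|^2], the equation asks that the second derivative of the
solution in the direction of its gradient [p], plus the drift
[F(x, p) = <Lambda(x, |p|), p> / |p|], be nonnegative for a subsolution. As [F]
is odd in [p], replacing both functions by their negatives exchanges the two
assertions, and both say that [f + V] is at most its maximum on the frontier
when [f] is a subsolution and [V] a subsolution with the extra property that
the gradients of functions touching it from above have length at least [eps]
([contact_comparison]). Testing against quadratic polynomials is enough, so
viscosity solutions enter only through the contact relation [touches].

Strictness. If [f + V] were larger inside, replace [V] by
[V + (eta / k) exp(k V)]. This adds [eta k exp(k V) |p|^2] to the second-order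
part and dilates the gradient, which changes the drift by the Lipschitz
condition on [Theta]; since [|p| >= eps], the gain wins for large [k], and the
new function is a subsolution with a margin [mu > 0] ([steepen_strict]).

Doubling. Maximise [f(x) + V(y)] minus a quadratic penalty of [x - y] with
parameter [j]. At a maximum [(a, b)] the gradient [p = j (a - b)] has length
at least [eps] because it touches [V], and at most a constant independent of
[j] because subsolutions are locally Lipschitz ([subsolution_slope_bound]):
by the condition on [Theta], [Theta] grows logarithmically, so that steep
concave cones are strict supersolutions. Hence [F(a, p)] and [F(b, p)] become
equal in the limit [j -> oo].

The second-order step avoids twice differentiable points of semiconvex
functions. Only the second derivative along the gradient matters, and it is
captured by cones. Let [f^] and [V^] be the sup-convolutions with parameter
[j], and let [M] be the maximum of [f^(xi) + V^(xi')] over pairs with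
[|xi - xi'| <= 2 r], attained at [(al, be)] with midpoint [z]. On the ball of
radius [2 r] about [z], the maximality gives [f^ <= M - V^(z)], and comparison
with a cone with vertex [z] bent by [kap_f] gives
[f^(al) <= (f^(z) + M - V^(z)) / 2 - kap_f r^2 / 2] ([half_way_bound]).
Adding the same estimate for [V^] at [be] yields
[M <= M - (kap_f + kap_V) r^2 / 2], which is absurd when [kap_f + kap_V > 0].
Sup-convolution serves to confine all gradients met in this comparison to a
small neighbourhood of [p] and of [- p] respectively ([realiser_close]); there
the drift is nearly constant, so [kap_f] close to [- F(a, p)] and [kap_V] close
to [F(b, p) + mu] are admissible ([doubling_contradiction]). *)

(** * Euclidean structure of row vectors *)

Section Euclid.
Variables (R : realType) (d : nat).
Implicit Types (p q x y h : 'rV[R]_d) (a t : R).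

Lemma dotC p q : dot p q = dot q p.
Proof. by apply: eq_bigr => i _; rewrite mulrC. Qed.

Lemma dotDl p q x : dot (p + q) x = dot p x + dot q x.
Proof. by rewrite -big_split; apply: eq_bigr => i _; rewrite !mxE mulrDl. Qed.

Lemma dotZl a p q : dot (a *: p) q = a * dot p q.
Proof. by rewrite mulr_sumr; apply: eq_bigr => i _; rewrite !mxE mulrA. Qed.

Lemma dotNl p q : dot (- p) q = - dot p q.
Proof. by rewrite -scaleN1r dotZl mulN1r. Qed.

Lemma dot0l q : dot 0 q = 0.
Proof. by rewrite -(scale0r q) dotZl mul0r. Qed.

Lemma dotDr p q x : dot x (p + q) = dot x p + dot x q.
Proof. by rewrite dotC dotDl !(dotC x). Qed.

Lemma dotZr a p q : dot p (a *: q) = a * dot p q.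
Proof. by rewrite dotC dotZl dotC. Qed.

Lemma dotNr p q : dot p (- q) = - dot p q.
Proof. by rewrite dotC dotNl dotC. Qed.

Lemma dot0r q : dot q 0 = 0.
Proof. by rewrite dotC dot0l. Qed.

Definition dotE := (dotDl, dotDr, dotNl, dotNr, dotZl, dotZr, dot0l, dot0r).

Lemma dotxx_ge0 p : 0 <= dot p p.
Proof. by apply: sumr_ge0 => i _; rewrite -expr2 sqr_ge0. Qed.

Lemma dotxx_eq0 p : dot p p = 0 -> p = 0.
Proof.
move=> /eqP; rewrite psumr_eq0 => [/allP p0|i _]; last by rewrite -expr2 sqr_ge0.
apply/rowP => i; rewrite mxE.
by have := p0 i (mem_index_enum _); rewrite /= mulf_eq0 orbb => /eqP.
Qed.

Lemma enorm_ge0 p : 0 <= enorm p.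
Proof. exact: sqrtr_ge0. Qed.

Lemma sqr_enorm p : enorm p ^+ 2 = dot p p.
Proof. by rewrite sqr_sqrtr // dotxx_ge0. Qed.

Lemma enorm0 : enorm (0 : 'rV[R]_d) = 0.
Proof. by rewrite /enorm dot0l sqrtr0. Qed.

Lemma enorm_eq0 p : enorm p = 0 -> p = 0.
Proof. by move=> p0; apply: dotxx_eq0; rewrite -sqr_enorm p0 expr0n. Qed.

Lemma enorm_gt0 p : p != 0 -> 0 < enorm p.
Proof.
move=> p0; rewrite lt_neqAle enorm_ge0 andbT eq_sym.
by apply/eqP => /enorm_eq0 /eqP; rewrite (negbTE p0).
Qed.

Lemma enormZ a p : enorm (a *: p) = `|a| * enorm p.
Proof.
by rewrite /enorm dotZl dotZr mulrA -expr2 sqrtrM ?sqr_ge0 // sqrtr_sqr.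
Qed.

Lemma enormN p : enorm (- p) = enorm p.
Proof. by rewrite -scaleN1r enormZ normrN1 mul1r. Qed.

Lemma enormB p q : enorm (p - q) = enorm (q - p).
Proof. by rewrite -opprB enormN. Qed.

Lemma cauchy_schwarz p q : dot p q <= enorm p * enorm q.
Proof.
have [->|p0] := eqVneq p 0; first by rewrite dot0l enorm0 mul0r.
have [->|q0] := eqVneq q 0; first by rewrite dot0r enorm0 mulr0.
have np := enorm_gt0 p0; have nq := enorm_gt0 q0.
have := dotxx_ge0 (enorm q *: p - enorm p *: q).
rewrite !dotE -!sqr_enorm (dotC q p).
set a := enorm p in np *; set b := enorm q in nq *; set c := dot p q => H.
have ab : 0 < a * b by rewrite mulr_gt0.
have : 0 <= (a * b) * (a * b - c) by nra.
by rewrite pmulr_rge0 // subr_ge0.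
Qed.

Lemma ler_abs_dot p q : `|dot p q| <= enorm p * enorm q.
Proof.
rewrite ler_norml cauchy_schwarz andbT.
by rewrite -[X in X * _]enormN -[dot p q]opprK -dotNl lerN2 cauchy_schwarz.
Qed.

Lemma enormD p q : enorm (p + q) <= enorm p + enorm q.
Proof.
rewrite -(@ler_pXn2r _ 2) ?nnegrE ?addr_ge0 ?enorm_ge0 //.
rewrite sqr_enorm !dotE (dotC q p) -!sqr_enorm.
have := cauchy_schwarz p q; nra.
Qed.

Lemma enorm_sub_le p q : enorm p - enorm q <= enorm (p - q).
Proof. by rewrite lerBlDr -{1}(subrK q p) enormD. Qed.

Lemma abs_enormB p q : `|enorm p - enorm q| <= enorm (p - q).
Proof.
by rewrite ler_norml enorm_sub_le andbT lerNl opprB (enormB p) enorm_sub_le.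
Qed.

Lemma enormB_triangle y x z : enorm (x - z) <= enorm (x - y) + enorm (y - z).
Proof. by apply: le_trans (enormD _ _); rewrite addrA subrK. Qed.

(** The two norms are equivalent, so Euclidean balls generate the topology
that row vectors carry. *)
Lemma norm_le_enorm p : `|p| <= enorm p.
Proof.
rewrite /Num.norm/= mx_normrE; apply/bigmax_leP; split; first exact: enorm_ge0.
move=> [i j] _ /=; rewrite ord1.
rewrite -(@ler_pXn2r _ 2) ?nnegrE ?enorm_ge0 // sqr_enorm -normrX.
rewrite ger0_norm ?sqr_ge0 // /dot (bigD1 j) //= -expr2 lerDl.
by apply: sumr_ge0 => k _; rewrite -expr2 sqr_ge0.
Qed.

Lemma enorm_le_norm p : enorm p <= d%:R * `|p|.
Proof.
rewrite -(@ler_pXn2r _ 2) ?nnegrE ?enorm_ge0 ?mulr_ge0 // sqr_enorm.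
have le1 i : p 0 i * p 0 i <= `|p| ^+ 2.
  rewrite -expr2 -real_normK ?num_real // ler_pXn2r ?nnegrE //.
  by rewrite [leRHS]/Num.norm/= mx_normrE; apply: (le_bigmax _ _ (0, i)).
apply: (@le_trans _ _ (\sum_(i < d) `|p| ^+ 2)); first exact: ler_sum.
rewrite sumr_const card_ord -[_ *+ d]mulr_natl exprMn ler_wpM2r ?sqr_ge0 //.
by rewrite -natrX ler_nat; case: (d) => // n; rewrite -mulnn leq_pmulr.
Qed.

Lemma nbhs_enorm x (P : set 'rV[R]_d) :
  nbhs x P <-> exists2 e : R, 0 < e & forall y, enorm (y - x) < e -> P y.
Proof.
split.
  move=> /nbhs_ballP [e /= e0 eP]; exists e => // y yx; apply: eP.
  rewrite -ball_normE /= distrC.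
  exact: le_lt_trans (norm_le_enorm _) yx.
move=> [e e0 eP]; apply/nbhs_ballP; exists (e / d.+1%:R) => /=.
  by rewrite divr_gt0.
move=> y; rewrite -ball_normE /= distrC => yx; apply: eP.
apply: le_lt_trans (enorm_le_norm _) _.
apply: (@le_lt_trans _ _ (d.+1%:R * `|y - x|)).
  by rewrite ler_wpM2r // ler_nat.
by rewrite mulrC -ltr_pdivlMr.
Qed.

Lemma enorm_continuous : continuous (@enorm R d).
Proof.
move=> x; apply/(@cvgrPdist_lt _ R^o _ (nbhs x)) => e e0.
apply/nbhs_enorm; exists e => // y.
by move=> yx; rewrite distrC; apply: le_lt_trans (abs_enormB _ _) yx.
Qed.

End Euclid.

(** * Compactness *)

Section Compactness.
Variable R : realType.

Lemma within_continuous_near (T : topologicalType) (A : set T) (f : T -> R) x (e : R) :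
  {within A, continuous f} -> A x -> 0 < e ->
  \forall y \near x, A y -> `|f y - f x| < e.
Proof.
move=> /subspace_continuousP cf Ax e0.
move/cvgrPdist_lt: (cf x Ax) => /(_ e e0).
by rewrite near_withinE; apply: filterS => y h Ay; rewrite distrC; exact: h.
Qed.

Lemma continuous_near (T : topologicalType) (f : T -> R) x (e : R) :
  continuous f -> 0 < e -> \forall y \near x, `|f y - f x| < e.
Proof.
move=> cf e0; move/cvgrPdist_lt: (cf x) => /(_ e e0).
by apply: filterS => y; rewrite distrC.
Qed.

Lemma near_within_continuous (T : topologicalType) (A : set T) (f : T -> R) :
  (forall x, A x -> forall e, 0 < e ->
    \forall y \near x, A y -> `|f y - f x| < e) ->
  {within A, continuous f}.
Proof.
move=> H; apply/subspace_continuousP => x Ax; apply/cvgrPdist_lt => e e0.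
rewrite near_withinE; have := H x Ax e e0.
by apply: filterS => y h Ay; rewrite distrC; exact: h.
Qed.

Lemma continuous_add (T : topologicalType) (f g : T -> R) :
  continuous f -> continuous g -> continuous (fun x => f x + g x).
Proof. by move=> cf cg x; apply: cvgD; [exact: cf|exact: cg]. Qed.

Lemma continuous_mul (T : topologicalType) (f g : T -> R) :
  continuous f -> continuous g -> continuous (fun x => f x * g x).
Proof. by move=> cf cg x; apply: cvgM; [exact: cf|exact: cg]. Qed.

Lemma continuous_opp (T : topologicalType) (f : T -> R) :
  continuous f -> continuous (fun x => - f x).
Proof. by move=> cf x; apply: cvgN; exact: cf. Qed.

Lemma continuous_compose (T : topologicalType) (f : T -> R) (g : R -> R) :
  continuous f -> continuous g -> continuous (fun x => g (f x)).
Proof. by move=> cf cg x; apply: (continuous_comp (cf x)); exact: cg. Qed.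

Lemma continuous_cst (T : topologicalType) (c : R) :
  continuous (fun _ : T => c).
Proof. by move=> x; exact: cvg_cst. Qed.

(** Sup-convolutions and doubled functions are both maximised in this form:
functions of one variable each, continuous only on the compact sets, plus a
coupling [h] that is continuous everywhere. *)
Lemma max_pair (T1 T2 : topologicalType) (A : set T1) (B : set T2)
    (f : T1 -> R) (g : T2 -> R) (h : T1 * T2 -> R) :
  A !=set0 -> B !=set0 -> compact A -> compact B ->
  {within A, continuous f} -> {within B, continuous g} -> continuous h ->
  exists a b, [/\ A a, B b & forall x y, A x -> B y ->
    f x + g y + h (x, y) <= f a + g b + h (a, b)].
Proof.
move=> [a0 Aa0] [b0 Bb0] cA cB cf cg ch.
have := @compact_EVT_max _ R (fun z : T1 * T2 => f z.1 + g z.2 + h z)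
  (A `*` B) (ex_intro _ (a0, b0) (conj Aa0 Bb0)) (compact_setX cA cB).
case.
  apply: near_within_continuous => -[x y] [/= Ax By] e e0.
  have e3 : 0 < e / 3 by rewrite divr_gt0.
  have UV : \forall z \near (x, y), (A z.1 -> `|f z.1 - f x| < e / 3) /\
      (B z.2 -> `|g z.2 - g y| < e / 3).
    exists ([set z | A z -> `|f z - f x| < e / 3],
            [set z | B z -> `|g z - g y| < e / 3]).
      by split; [exact: within_continuous_near cf Ax e3
                |exact: within_continuous_near cg By e3].
    by move=> z [/= Uz Vz]; split.
  near=> z => -[Az Bz].
  have [] : (A z.1 -> `|f z.1 - f x| < e / 3) /\
      (B z.2 -> `|g z.2 - g y| < e / 3) by near: z.
  move=> /(_ Az) Uz /(_ Bz) Vz.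
  have : `|h z - h (x, y)| < e / 3.
    by near: z; exact: (@continuous_near _ h (x, y) _ ch e3).
  move: Uz Vz; rewrite !ltr_norml; lra.
move=> [a b]; rewrite inE => -[/= Aa Bb] max; exists a, b; split => // x y Ax By.
by apply: (max (x, y)); rewrite inE.
Unshelve. all: by end_near.
Qed.

Lemma max_one (T : topologicalType) (A : set T) (f h : T -> R) :
  A !=set0 -> compact A -> {within A, continuous f} -> continuous h ->
  exists2 a, A a & forall x, A x -> f x + h x <= f a + h a.
Proof.
move=> A0 cA cf ch.
have [|a] := @compact_EVT_max _ R (fun z => f z + h z) A A0 cA.
  apply: near_within_continuous => x Ax e e0.
  have e2 : 0 < e / 2 by rewrite divr_gt0.
  near=> z => Az.
  have : `|f z - f x| < e / 2.
    by move: Az; near: z; exact: within_continuous_near cf Ax e2.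
  have : `|h z - h x| < e / 2.
    by near: z; exact: (@continuous_near _ h x _ ch e2).
  rewrite !ltr_norml; lra.
rewrite inE => Aa max; exists a => // x Ax.
by apply: max; rewrite inE.
Unshelve. all: by end_near.
Qed.

(** Serves as Lebesgue's number lemma in [uniform_interior] and as the
Heine-Cantor theorem in [drift_uniform]. *)
Lemma uniform_scale (T : topologicalType) (K : set T) (P : R -> T -> Prop) :
  compact K ->
  (forall x, K x -> exists2 e : R, 0 < e &
     \forall y \near x, K y -> forall t, 0 < t < e -> P t y) ->
  exists2 e : R, 0 < e & forall x, K x -> P e x.
Proof.
move=> /compact_near_coveringP cK H.
have HH : \forall t \near (0 : R)^'+, K `<=` (fun x => K x -> P t x).
  apply: (cK R _ (fun t x => K x -> P t x)) => x Kx.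
  have [e e0 He] := H x Kx.
  exists ([set y | K y -> forall t, 0 < t < e -> P t y], [set t | 0 < t < e]).
    split => //=; near=> t; apply/andP.
    by split; near: t; [exact: nbhs_right_gt|exact: nbhs_right_lt].
  by move=> [y t] [/= yP te] Ky; exact: yP.
near (0 : R)^'+ => e; exists e; first by near: e; exact: nbhs_right_gt.
by move=> x Kx; apply: (near HH e).
Unshelve. all: by end_near.
Qed.

End Compactness.

(** * From viscosity solutions to quadratic contact *)

Section Touching.
Variables (R : realType) (d : nat).
Implicit Types (f : 'rV[R]_d -> R) (x p h v : 'rV[R]_d) (A B : R).

(** Second-order contact from above with gradient [p], whose Hessian is
restricted to the form [2 A I + 2 B p^T p]. Radial comparison functions only
produce such Hessians, and the class is stable under composition with a
function of one variable. *)
Definition touches f x p A B : Prop :=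
  forall eta : R, 0 < eta -> exists2 r : R, 0 < r & forall h, enorm h < r ->
    f (x + h) <= f x + dot p h + (A + eta) * dot h h + B * dot p h ^+ 2.

Definition quadratic x p A B (y : 'rV[R]_d) : R :=
  dot p (y - x) + A * dot (y - x) (y - x) + B * dot p (y - x) ^+ 2.

Lemma is_derive_quadratic f x v (L Q : R) :
  (forall t : R, f (t *: v + x) = f x + t * L + t ^+ 2 * Q) ->
  is_derive x v f L.
Proof.
move=> H.
have cv : h^-1 *: ((f \o shift x) (h *: v) - f x) @[h --> (0 : R)^'] --> L.
  have : (fun t : R => L + t * Q) @ (0 : R)^' --> L + 0 * Q.
    apply: cvg_within_filter; apply: cvgD; first exact: cvg_cst.
    by apply: cvgM; [exact: cvg_id|exact: cvg_cst].
  rewrite mul0r addr0; apply: cvg_trans; apply: near_eq_cvg.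
  near=> t; have t0 : t != 0 by near: t; exact: nbhs_dnbhs_neq.
  rewrite /= H -[_ *: _]/(t^-1 * _); field.
  by [].
apply: DeriveDef; first by apply/cvg_ex; exists L.
exact: cvg_lim.
Unshelve. all: by end_near.
Qed.

Lemma affine_continuous p x (c : R) :
  continuous (fun y : 'rV[R]_d => c + dot p (y - x)).
Proof.
move=> y; apply/(@cvgrPdist_lt _ R^o _ (nbhs y)) => e e0.
apply/nbhs_enorm; exists (e / (enorm p + 1)).
  by rewrite divr_gt0 // ltr_wpDl ?enorm_ge0.
move=> z; rewrite ltr_pdivlMr ?ltr_wpDl ?enorm_ge0 // => zy.
rewrite (_ : _ - _ = dot p (y - z)); last by rewrite !dotE; ring.
apply: le_lt_trans (ler_abs_dot _ _) _.
rewrite enormB; have := enorm_ge0 (z - y); lra.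
Qed.

Lemma distance_continuous x : continuous (fun y : 'rV[R]_d => enorm (y - x)).
Proof.
move=> y; apply/(@cvgrPdist_lt _ R^o _ (nbhs y)) => e e0.
apply/nbhs_enorm; exists e => // z zy; apply: le_lt_trans (abs_enormB _ _) _.
by rewrite enormB opprB addrA subrK.
Qed.

Lemma quadratic_continuous x p A B : continuous (quadratic x p A B).
Proof.
have cl : continuous (fun y : 'rV[R]_d => dot p (y - x)).
  under eq_fun do rewrite -[dot _ _]add0r; exact: affine_continuous.
apply: continuous_add; first apply: continuous_add => //.
- apply: continuous_mul; first exact: continuous_cst.
  under eq_fun do rewrite -sqr_enorm expr2.
  by apply: continuous_mul; exact: distance_continuous.
- apply: continuous_mul; first exact: continuous_cst.
  by under eq_fun do rewrite expr2; exact: continuous_mul.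
Qed.

Lemma dot_delta p (i : 'I_d) : dot p (delta_mx 0 i) = p 0 i.
Proof.
rewrite /dot (bigD1 i) //= mxE !eqxx mulr1 big1 ?addr0 // => j ji.
by rewrite mxE (negbTE ji) andbF mulr0.
Qed.

(** The gradient of the [i]-th partial derivative of a quadratic. *)
Definition hess_row p A B (i : 'I_d) : 'rV[R]_d :=
  (2 * A) *: delta_mx 0 i + (2 * B * p 0 i) *: p.

Lemma is_derive_affine p x (c : R) y v :
  is_derive y v (fun z => c + dot p (z - x)) (dot p v).
Proof.
apply: (@is_derive_quadratic _ _ _ _ 0) => t; rewrite !dotE; ring.
Qed.

Lemma is_derive_quad x p A B y (i : 'I_d) :
  is_derive y (delta_mx 0 i) (quadratic x p A B)
    (p 0 i + dot (hess_row p A B i) (y - x)).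
Proof.
set v := delta_mx 0 i.
apply: (@is_derive_quadratic _ _ _ _ (A * dot v v + B * dot p v ^+ 2)) => t.
rewrite /quadratic /hess_row -/v -(dot_delta p) -/v.
rewrite (_ : t *: v + y - x = t *: v + (y - x)); last by rewrite addrA.
move: (y - x) => w; rewrite !dotE (dotC w v); ring.
Qed.

Lemma partial_quadratic x p A B (i : 'I_d) :
  partial i (quadratic x p A B) =
  (fun y => p 0 i + dot (hess_row p A B i) (y - x)).
Proof.
by apply/funext => y; have H := is_derive_quad x p A B y i; exact: derive_val.
Qed.

Lemma partial_affine p x (c : R) (i : 'I_d) :
  partial i (fun y => c + dot p (y - x)) = cst (p 0 i).
Proof.
apply/funext => y; have H := is_derive_affine p x c y (delta_mx 0 i).
by rewrite /cst -dot_delta; exact: derive_val.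
Qed.

Lemma Ck_closure_quadratic U x p A B : Ck_closure 2 U (quadratic x p A B).
Proof.
have cq := @quadratic_continuous x p A B.
have sub f : continuous f -> {within closure U, continuous f}.
  by move=> cf; exact: continuous_subspaceT.
split; first exact: sub.
split; first by exists (quadratic x p A B) => //; exact: sub.
move=> i; split.
  by move=> y _; have H := is_derive_quad x p A B y i; exact: ex_derive.
rewrite partial_quadratic; split.
  exists (fun y => p 0 i + dot (hess_row p A B i) (y - x)) => //.
  by apply: sub; exact: affine_continuous.
move=> j; split.
  move=> y _; have H := is_derive_affine (hess_row p A B i) x (p 0 i) y
    (delta_mx 0 j); exact: ex_derive.
rewrite partial_affine; split => //.
by exists (cst (hess_row p A B i 0 j)) => //; apply: sub; exact: continuous_cst.
Qed.

Lemma grad_quadratic x p A B : grad (quadratic x p A B) x = p.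
Proof.
by apply/rowP => i; rewrite mxE partial_quadratic subrr dot0r addr0.
Qed.

Lemma hess_quadratic x p A B : p *m (hess (quadratic x p A B) x)^T =
  (2 * A + 2 * B * dot p p) *: p.
Proof.
apply/rowP => i; rewrite !mxE.
transitivity (dot p (hess_row p A B i)).
  apply: eq_bigr => j _; rewrite !mxE partial_quadratic partial_affine.
  by rewrite /cst /hess_row !mxE.
rewrite /hess_row !dotE dot_delta; ring.
Qed.

End Touching.

Section ViscosityTouching.
Variables (R : realType) (d : nat) (Omega : set 'rV[R]_d).
Variable Lambda : 'rV[R]_d -> R -> 'rV[R]_d.
Implicit Types (f u v : 'rV[R]_d -> R) (x p h : 'rV[R]_d) (A B : R).

(** The first-order part of the operator, divided by [|p|^2] like the
second-order part in [normalized]. *)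
Definition drift x p : R := dot (Lambda x (enorm p)) p / enorm p.

Lemma driftN x p : drift x (- p) = - drift x p.
Proof. by rewrite /drift enormN dotNr mulNr. Qed.

(** [-|p|^-2] times the operator, on the Hessian that [touches] refers to. *)
Definition normalized x p A B : R := 2 * A + 2 * B * dot p p + drift x p.

Lemma normalizedN x p A B : normalized x (- p) (- A) (- B) = - normalized x p A B.
Proof. by rewrite /normalized driftN !dotE; ring. Qed.

Lemma neg_inf_laplacian_quadratic x p A B : p != 0 ->
  neg_inf_laplacian Lambda x p (hess (quadratic x p A B) x) =
  - dot p p * normalized x p A B.
Proof.
move=> p0; rewrite /neg_inf_laplacian (negbTE p0) hess_quadratic dotZl.
rewrite /normalized /drift -sqr_enorm; have := enorm_gt0 p0 => np.
by field; rewrite gt_eqF.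
Qed.

Lemma touches_strict f x p A B (eta : R) : 0 < eta -> touches f x p A B ->
  \forall y \near x^', f y - quadratic x p (A + eta) B y <
                       f x - quadratic x p (A + eta) B x.
Proof.
move=> eta0 tf; have [|r r0 Hr] := tf (eta / 2); first by rewrite divr_gt0.
rewrite near_withinE; apply/nbhs_enorm; exists r => // y yx /= yneq.
have := Hr _ yx; rewrite (addrC x) subrK /quadratic subrr !dot0r.
have : 0 < dot (y - x) (y - x).
  by rewrite -sqr_enorm exprn_gt0 // enorm_gt0 // subr_eq0.
move: (y - x) => h; nra.
Qed.

Lemma subsolution_touches G u x p A B (eta : R) :
  viscosity_subsolution Omega G u -> Omega x -> touches u x p A B -> 0 < eta ->
  G x p (hess (quadratic x p (A + eta) B) x) <= 0.
Proof.
move=> [_ H] Ox tu eta0; rewrite -[X in G x X](grad_quadratic x p (A + eta) B).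
apply: H => //; first exact: Ck_closure_quadratic.
exact: touches_strict.
Qed.

Lemma supersolution_touches G v x p A B (eta : R) :
  viscosity_supersolution Omega G v -> Omega x ->
  touches (fun y => - v y) x p A B -> 0 < eta ->
  0 <= G x (- p) (hess (quadratic x (- p) (- (A + eta)) (- B)) x).
Proof.
move=> [_ H] Ox tv eta0.
rewrite -[X in G x X](grad_quadratic x (- p) (- (A + eta)) (- B)).
apply: H => //; first exact: Ck_closure_quadratic.
have := touches_strict eta0 tv; apply: filterS => y.
rewrite /quadratic subrr !dot0r; move: (y - x) => h; rewrite !dotE; lra.
Qed.

Lemma ge0_of_near x p A B :
  (forall eta : R, 0 < eta -> 0 <= normalized x p (A + eta) B) ->
  0 <= normalized x p A B.
Proof.
move=> H; apply/ler_addgt0Pl => e e0.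
have := H (e / 2) (divr_gt0 e0 (ltr0Sn _ 1)); rewrite /normalized; lra.
Qed.

Definition subsolution_at_contact f := forall x p A B,
  Omega x -> touches f x p A B -> p != 0 -> 0 <= normalized x p A B.

(** Subsolutions of the maximum with [eps - |p|]. *)
Definition steep_subsolution_at_contact (eps : R) f := forall x p A B,
  Omega x -> touches f x p A B -> eps <= enorm p /\ 0 <= normalized x p A B.

Lemma dot_gt0 p : p != 0 -> 0 < dot p p.
Proof. by move=> p0; rewrite -sqr_enorm exprn_gt0 // enorm_gt0. Qed.

Lemma subsolution_contact u :
  viscosity_subsolution Omega (neg_inf_laplacian Lambda) u ->
  subsolution_at_contact u.
Proof.
move=> Hu x p A B Ox tu p0; apply: ge0_of_near => eta eta0.
have := subsolution_touches Hu Ox tu eta0.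
by rewrite neg_inf_laplacian_quadratic // mulNr oppr_le0 pmulr_rge0 // dot_gt0.
Qed.

Lemma supersolution_contact v :
  viscosity_supersolution Omega (neg_inf_laplacian Lambda) v ->
  subsolution_at_contact (fun y => - v y).
Proof.
move=> Hv x p A B Ox tv p0; apply: ge0_of_near => eta eta0.
have := supersolution_touches Hv Ox tv eta0.
rewrite neg_inf_laplacian_quadratic ?oppr_eq0 // normalizedN !dotE opprK mulNr.
by rewrite mulrN opprK pmulr_rge0 // dot_gt0.
Qed.

Lemma max_subsolution_contact (eps : R) v : 0 < eps ->
  viscosity_subsolution Omega (max_operator Lambda eps) v ->
  steep_subsolution_at_contact eps v.
Proof.
move=> eps0 Hv x p A B Ox tv.
have H eta : 0 < eta -> eps - enorm p <= 0 /\
    neg_inf_laplacian Lambda x p (hess (quadratic x p (A + eta) B) x) <= 0.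
  move=> eta0; have := subsolution_touches Hv Ox tv eta0.
  by rewrite /max_operator ge_max => /andP.
have ep : eps <= enorm p by have [] := H 1 ltr01; rewrite subr_le0.
have p0 : p != 0.
  by apply/eqP => pz; move: ep; rewrite pz enorm0 leNgt eps0.
split => //; apply: ge0_of_near => eta eta0; have [_] := H _ eta0.
by rewrite neg_inf_laplacian_quadratic // mulNr oppr_le0 pmulr_rge0 // dot_gt0.
Qed.

Lemma min_supersolution_contact (eps : R) v : 0 < eps ->
  viscosity_supersolution Omega (min_operator Lambda eps) v ->
  steep_subsolution_at_contact eps (fun y => - v y).
Proof.
move=> eps0 Hv x p A B Ox tv.
have H eta : 0 < eta -> 0 <= enorm (- p) - eps /\
    0 <= neg_inf_laplacian Lambda x (- p)
          (hess (quadratic x (- p) (- (A + eta)) (- B)) x).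
  move=> eta0; have := supersolution_touches Hv Ox tv eta0.
  by rewrite /min_operator le_min => /andP.
have ep : eps <= enorm p by have [] := H 1 ltr01; rewrite subr_ge0 enormN.
have p0 : p != 0.
  by apply/eqP => pz; move: ep; rewrite pz enorm0 leNgt eps0.
split => //; apply: ge0_of_near => eta eta0; have [_] := H _ eta0.
rewrite neg_inf_laplacian_quadratic ?oppr_eq0 // normalizedN !dotE opprK mulNr.
by rewrite mulrN opprK pmulr_rge0 // dot_gt0.
Qed.

End ViscosityTouching.

(** * Contact with radial functions *)

Section Radial.
Variables (R : realType) (d : nat).
Implicit Types (f : 'rV[R]_d -> R) (x p k h w : 'rV[R]_d) (s kap A B : R).

(** The profile of a cone of slope [s] at its vertex, bent with second
derivative [kap]. *)
Definition bent_cone s kap (t : R) : R := s * t + kap / 2 * t ^+ 2.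

Lemma bent_coneB s kap (t0 t : R) :
  bent_cone s kap (t0 + t) - bent_cone s kap t0 =
  (s + kap * t0) * t + kap / 2 * t ^+ 2.
Proof. by rewrite /bent_cone; field. Qed.

(** With [t = |k + h| - |k|] and [nu = <k, h> / |k|], the identity
[2 |k| t + t^2 = 2 |k| nu + |h|^2] shows that [t] and [nu] differ by
[O(|h|^2)], hence their squares by [O(|h|^3)]. *)
Lemma radial_increment k h : k != 0 ->
  let t := enorm (k + h) - enorm k in
  let nu := dot k h / enorm k in
  t - nu = (dot h h - t ^+ 2) / (2 * enorm k) /\
  `|t ^+ 2 - nu ^+ 2| <= enorm h ^+ 3 / enorm k.
Proof.
move=> k0 /=; have r0 := enorm_gt0 k0.
set rho := enorm k in r0 *; set t := _ - rho; set nu := _ / rho.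
have E : 2 * rho * t + t ^+ 2 = 2 * rho * nu + dot h h.
  have := sqr_enorm (k + h); rewrite !dotE (dotC h k) -(sqr_enorm k) -/rho.
  rewrite (_ : enorm (k + h) = rho + t); last by rewrite /t; ring.
  rewrite (_ : dot k h = rho * nu); last by rewrite /nu; field; rewrite gt_eqF.
  by move=> H; nra.
have tnu : t - nu = (dot h h - t ^+ 2) / (2 * rho).
  apply: (mulfI (_ : 2 * rho != 0)); first by rewrite mulf_neq0 ?gt_eqF.
  rewrite [RHS]mulrC divfK ?mulf_neq0 ?gt_eqF //; nra.
split => //.
have th : `|t| <= enorm h.
  by apply: le_trans (abs_enormB _ _) _; rewrite addrC addKr.
have nuh : `|nu| <= enorm h.
  rewrite normrM normfV (gtr0_norm r0) ler_pdivrMr // mulrC.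
  exact: ler_abs_dot.
have t2 : t ^+ 2 <= enorm h ^+ 2.
  by rewrite -real_normK ?num_real // ler_pXn2r ?nnegrE ?enorm_ge0.
rewrite subr_sqr tnu -sqr_enorm normrM ger0_norm; last first.
  by rewrite divr_ge0 ?mulr_ge0 ?subr_ge0 // ltW.
have tn : `|t + nu| <= 2 * enorm h.
  apply: le_trans (ler_normD _ _) _; lra.
apply: (@le_trans _ _ (enorm h ^+ 2 / (2 * rho) * (2 * enorm h))).
  apply: ler_pM => //.
    by rewrite divr_ge0 ?mulr_ge0 ?subr_ge0 // ltW.
  rewrite ler_pM2r ?invr_gt0 ?mulr_gt0 // gerBl; exact: sqr_ge0.
rewrite le_eqVlt; apply/orP; left; apply/eqP; field.
by rewrite gt_eqF.
Qed.

(** Along its gradient a bent cone has second derivative [kap], whatever the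
curvature of its level sets; [A] accounts for the latter. *)
Lemma radial_contact f x k s kap : k != 0 -> s + kap * enorm k != 0 ->
  (exists2 r : R, 0 < r & forall h, enorm h < r ->
    f (x + h) - f x <= bent_cone s kap (enorm (k + h)) - bent_cone s kap (enorm k)) ->
  let p := ((s + kap * enorm k) / enorm k) *: k in
  exists A B, touches f x p A B /\ 2 * A + 2 * B * dot p p = kap.
Proof.
move=> k0; set c := s + _ => c0 [r r0 Hr] /=; have n0 := enorm_gt0 k0.
set rho := enorm k in Hr c n0 c0 *.
exists (c / (2 * rho)), ((kap / 2 - c / (2 * rho)) / c ^+ 2).
split; last first.
  rewrite !dotE -sqr_enorm -/rho; field.
  by rewrite c0 gt_eqF.
move=> eta eta0; set E := kap / 2 - c / (2 * rho).
have E1 : 0 < `|E| + 1 by rewrite ltr_wpDl.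
exists (Order.min r (eta * rho / (`|E| + 1))).
  by rewrite lt_min r0 divr_gt0 // mulr_gt0.
move=> h; rewrite lt_min => /andP[hr he].
have := Hr _ hr; have [] := radial_increment h k0; rewrite -/rho.
set t := enorm (k + h) - rho; set nu := _ / rho => tnu t2.
rewrite (_ : enorm (k + h) = rho + t); last by rewrite /t; ring.
rewrite bent_coneB -/c => Hf.
rewrite dotZl (_ : c / rho * dot k h = c * nu); last first.
  by rewrite /nu; field; rewrite gt_eqF.
rewrite (_ : E / c ^+ 2 * (c * nu) ^+ 2 = E * nu ^+ 2); last first.
  by field.
have main : E * (t ^+ 2 - nu ^+ 2) <= eta * dot h h.
  apply: le_trans (ler_norm _) _; rewrite normrM.
  apply: (@le_trans _ _ (`|E| * (enorm h ^+ 3 / rho))); first exact: ler_wpM2l.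
  rewrite -sqr_enorm.
  have eh := enorm_ge0 h.
  have : (`|E| + 1) * enorm h <= eta * rho.
    by rewrite mulrC -ler_pdivlMr // ltW.
  rewrite mulrA ler_pdivrMr // => H.
  have : `|E| * enorm h <= eta * rho by lra.
  have e3 : `|E| * enorm h ^+ 3 = enorm h ^+ 2 * (`|E| * enorm h).
    by move: (`|E|) (enorm h) => e y; ring.
  move=> H'; rewrite e3 -[leRHS]mulrA [leRHS]mulrCA.
  by apply: ler_wpM2l => //; exact: sqr_ge0.
have ct : c * t = c * nu + c / (2 * rho) * dot h h - c / (2 * rho) * t ^+ 2.
  rewrite (_ : c * t = c * nu + c * (t - nu)); last by ring.
  by rewrite tnu; field; rewrite gt_eqF.
move: Hf main; rewrite ct /E; lra.
Qed.

Lemma touches_gradient f x w p A B (C : R) : touches f x p A B ->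
  (forall h, f x + dot w h - C * dot h h <= f (x + h)) -> p = w.
Proof.
move=> tf H; apply/eqP; rewrite eq_sym -subr_eq0; apply/eqP/dotxx_eq0.
have [r r0 Hr] := tf 1 ltr01.
set g := w - p; apply/eqP; rewrite eq_le dotxx_ge0 andbT leNgt; apply/negP => g0.
have ng : 0 < enorm g by rewrite /enorm sqrtr_gt0.
set D := `|A| + 1 + `|B| * dot p p + `|C|.
have D0 : 0 < D.
  by rewrite /D -addrA -addrA ltr_wpDl // ltr_pwDl // addr_ge0 ?mulr_ge0 ?dotxx_ge0.
pose tau := Order.min (r / (2 * enorm g)) (1 / (2 * D)).
have tau0 : 0 < tau by rewrite /tau lt_min !divr_gt0 ?mulr_gt0.
have taur : tau * enorm g < r.
  have : tau <= r / (2 * enorm g) by rewrite /tau ge_min lexx.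
  rewrite ler_pdivlMr ?mulr_gt0 //; lra.
have tauD : tau * D <= 1 / 2.
  have : tau <= 1 / (2 * D) by rewrite /tau ge_min lexx orbT.
  rewrite ler_pdivlMr ?mulr_gt0 //; lra.
have := Hr (tau *: g); rewrite enormZ gtr0_norm // => /(_ taur).
have := H (tau *: g); set h := tau *: g => H1 H2.
have gh : dot w h - dot p h = tau * dot g g.
  by rewrite -dotNl -dotDl dotZr.
have hh : dot h h = tau ^+ 2 * dot g g by rewrite !dotE; ring.
have ph : dot p h ^+ 2 <= dot p p * dot h h.
  rewrite -!sqr_enorm -exprMn -[X in X <= _]real_normK ?num_real //.
  by rewrite ler_pXn2r ?nnegrE ?mulr_ge0 ?enorm_ge0 // ler_abs_dot.
have hh0 : 0 <= dot h h by exact: dotxx_ge0.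
have b1 : B * dot p h ^+ 2 <= `|B| * dot p p * dot h h.
  apply: (@le_trans _ _ (`|B| * dot p h ^+ 2)).
    by apply: ler_wpM2r; [exact: sqr_ge0|exact: ler_norm].
  by rewrite -mulrA ler_wpM2l.
have b2 : A * dot h h <= `|A| * dot h h by rewrite ler_wpM2r // ler_norm.
have b3 : C * dot h h <= `|C| * dot h h by rewrite ler_wpM2r // ler_norm.
have : tau * dot g g <= D * dot h h.
  by rewrite -gh /D; lra.
rewrite hh (_ : D * _ = (tau * D) * (tau * dot g g)); last by ring.
have := mulr_gt0 tau0 g0; nra.
Qed.

End Radial.

(** * Cone comparison for sup-convolutions *)

Section ConeComparison.
Variables (R : realType) (d : nat).
Implicit Types (f g : 'rV[R]_d -> R) (x y z a b k h : 'rV[R]_d).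

(** At the tip of the profile the Hessian does not have the form used in
[radial_contact]; all that is needed is that the gradient vanishes. *)
Lemma radial_contact_flat f x k (s kap : R) : k != 0 -> s + kap * enorm k = 0 ->
  (exists2 r : R, 0 < r & forall h, enorm h < r ->
    f (x + h) - f x <= bent_cone s kap (enorm (k + h)) - bent_cone s kap (enorm k)) ->
  touches f x 0 (`|kap| / 2) 0.
Proof.
move=> k0 c0 [r r0 Hr] eta eta0; exists r => // h hr; have := Hr _ hr.
rewrite (_ : enorm (k + h) = enorm k + (enorm (k + h) - enorm k)); last by ring.
rewrite bent_coneB c0 mul0r add0r dot0l mul0r !addr0.
set t := enorm (k + h) - enorm k; have th : t ^+ 2 <= dot h h.
  rewrite -real_normK ?num_real // -sqr_enorm ler_pXn2r ?nnegrE ?enorm_ge0 //.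
  by apply: le_trans (abs_enormB _ _) _; rewrite addrC addKr.
have : kap * t ^+ 2 <= `|kap| * dot h h.
  apply: (@le_trans _ _ (`|kap| * t ^+ 2)); last exact: ler_wpM2l.
  by apply: ler_wpM2r; [exact: sqr_ge0|exact: ler_norm].
have := mulr_ge0 (ltW eta0) (dotxx_ge0 h); nra.
Qed.

Lemma pair_distance_continuous :
  continuous (fun z : 'rV[R]_d * 'rV[R]_d => enorm (z.1 - z.2)).
Proof.
move=> [x y]; apply/(@cvgrPdist_lt _ R^o _ (nbhs (x, y))) => e e0.
have e2 : 0 < e / 2 by rewrite divr_gt0.
exists ([set x' | enorm (x' - x) < e / 2], [set y' | enorm (y' - y) < e / 2]).
  by split; apply/nbhs_enorm; exists (e / 2).
move=> [x' y'] [/= xx yy]; apply: le_lt_trans (abs_enormB _ _) _.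
rewrite (_ : _ - _ = (x - x') - (y - y')); last first.
  by apply/rowP => i; rewrite !mxE /=; ring.
apply: le_lt_trans (enormD _ _) _; rewrite enormN !(enormB _ x') !(enormB _ y').
lra.
Qed.

Lemma compact_enorm_ball z (T : R) : compact [set y | enorm (y - z) <= T].
Proof.
apply: bounded_closed_compact.
  exists (T + `|z|); split; first exact: num_real.
  move=> M MT y /= yz; apply/ltW; apply: le_lt_trans MT.
  rewrite -[y](subrK z); apply: le_trans (ler_normD _ _) _.
  by rewrite lerD2r; apply: le_trans (norm_le_enorm _) _.
rewrite (_ : [set _ | _] = (fun y => enorm (y - z)) @^-1` [set t | t <= T]) //.
apply: closed_comp; last exact: closed_le.
by move=> y _; exact: distance_continuous.
Qed.


Lemma bent_cone_continuous (s kap : R) : continuous (bent_cone s kap).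
Proof.
apply: continuous_add; apply: continuous_mul.
- exact: continuous_cst.
- by move=> t; exact: cvg_id.
- exact: continuous_cst.
- exact: exprn_continuous.
Qed.

(** The algebra behind [realiser_close]: two functions that are semiconvex with
constant [2 j] and whose sum is within [D] of its maximum have almost
opposite gradients. *)
Lemma semiconvex_gradient_gap (w c e : 'rV[R]_d) (j D M F Fa Fb : R) : 0 < j ->
  M - D <= Fa + Fb - j / 2 * dot (2 *: c) (2 *: c) ->
  Fa - j * dot (c - e) (c - e) <= F - j * dot (w + c) (w + c) ->
  (forall h, F - j * dot (w + c - h) (w + c - h) +
    (Fb - j * dot (- c - e - h) (- c - e - h)) <= M) ->
  j * dot w w <= 3 * D + 9 * (j * dot e e).
Proof.
(* [w / 3] maximises [2 <w, h> - 3 |h|^2], what is left after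
   [|e + h|^2 <= 2 |e|^2 + 2 |h|^2] *)
move=> j0 H1 H2 /(_ (3^-1 *: w)) H3; move: H1 H2 H3.
have := mulr_ge0 (ltW j0) (dotxx_ge0 (e - 3^-1 *: w)).
rewrite !dotE (dotC w c) (dotC w e) (dotC e c); lra.
Qed.

Section SupConvolution.
Variables (K : set 'rV[R]_d) (f g : 'rV[R]_d -> R) (j r D M omega tau kap : R).
Variables a b : 'rV[R]_d.
Hypothesis cK : compact K.
Hypothesis cf : {within K, continuous f}.
Hypotheses (j0 : 0 < j) (r0 : 0 < r) (om0 : 0 <= omega).
Hypotheses (Ka : K a) (Kb : K b).
Let z := 2^-1 *: (a + b).

(** A bound on the sum of the sup-convolutions of [f] and [g] with parameter
[j], at points no further apart than [2 r], written without suprema. *)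
Hypothesis HM : forall x y xi xi', K x -> K y -> enorm (xi - xi') <= 2 * r ->
  f x - j * dot (x - xi) (x - xi) + (g y - j * dot (y - xi') (y - xi')) <= M.
Hypothesis HD : M - D <= f a + g b - j / 2 * dot (a - b) (a - b).
Hypothesis Hom : 3 * D / j + 36 * r ^+ 2 <= omega ^+ 2.
Hypothesis Hp : 2 * j * omega < enorm (j *: (a - b)).
Hypothesis Htau : omega + 2 * r < tau.
Hypothesis KO : forall x, enorm (x - a) < tau -> K x.
Hypothesis Hcontact : forall x p A B, enorm (x - a) < tau ->
  enorm (p - j *: (a - b)) <= 2 * j * omega -> touches f x p A B ->
  kap < 2 * A + 2 * B * dot p p.

(** Both sup-convolutions lie within [D] of being touched at [z] by functions
with gradients [j (a - b)] and [- j (a - b)] and second derivatives at least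
[- 2 j]. Hence a point [x] realising the sup-convolution of [f] at [y]
satisfies [x - y] close to [(a - b) / 2]. *)
Lemma realiser_close x y : K x -> enorm (y - z) <= 2 * r ->
  (forall x', K x' -> f x' - j * dot (x' - y) (x' - y) <=
                      f x - j * dot (x - y) (x - y)) ->
  enorm (x - y - 2^-1 *: (a - b)) <= omega.
Proof.
move=> Kx yz mx.
pose c := 2^-1 *: (a - b); pose e := y - z; pose w := x - y - c.
have r20 : 0 <= 2 * r by rewrite mulr_ge0 ?ltW.
have ee : dot e e <= (2 * r) ^+ 2.
  by rewrite -sqr_enorm ler_pXn2r ?nnegrE ?enorm_ge0.
have W2 : j * dot w w <= 3 * D + 9 * (j * dot e e).
  apply: (@semiconvex_gradient_gap w c e j D M (f x) (f a) (g b)) => //.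
  - rewrite (_ : 2 *: c = a - b) //.
    by rewrite /c scalerA divff ?scale1r ?pnatr_eq0.
  - have := mx _ Ka; rewrite (_ : a - y = c - e); last first.
      by apply/rowP => i; rewrite /c /e /z !mxE; field.
    by rewrite (_ : x - y = w + c) // subrK.
  - move=> h; have := HM (xi := y + h) (xi' := y + h) Kx Kb.
    rewrite subrr enorm0 => /(_ r20).
    rewrite (_ : x - (y + h) = w + c - h); last first.
      by apply/rowP => i; rewrite /w !mxE; ring.
    rewrite (_ : b - (y + h) = - c - e - h) //.
    by apply/rowP => i; rewrite /w /c /e /z !mxE; field.
rewrite -(@ler_pXn2r _ 2) ?nnegrE ?enorm_ge0 // sqr_enorm.
apply: le_trans Hom; rewrite -/c -/w.
rewrite -(ler_pM2l j0) mulrDr (_ : j * (3 * D / j) = 3 * D); last first.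
  by field; rewrite gt_eqF.
apply: le_trans W2 _; rewrite lerD2l mulrCA ler_pM2l //.
rewrite (_ : 36 * r ^+ 2 = 9 * (2 * r) ^+ 2); last by ring.
by rewrite ler_pM2l.
Qed.

(** Comparison with a bent cone with vertex [z], whose height at distance
[2 r] is the bound that [g] imposes there. At an interior maximum
the contact condition [Hcontact] is violated, because the second derivative of
the cone is [kap]. *)
Lemma half_way_bound Uz Vz alpha x : 
  (forall x', K x' -> f x' - j * dot (x' - z) (x' - z) <= Uz) ->
  (exists2 y, K y & g y - j * dot (y - z) (y - z) = Vz) ->
  enorm (alpha - z) = r -> K x ->
  f x - j * dot (x - alpha) (x - alpha) <= (Uz + M - Vz) / 2 - kap / 2 * r ^+ 2.
Proof.
move=> HU [yV KyV HV] ralpha Kx.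
have r20 : 0 < 2 * r by rewrite mulr_gt0.
pose s := (M - Vz - Uz) / (2 * r) - kap * r.
pose B : set 'rV[R]_d := [set y | enorm (y - z) <= 2 * r].
have sT : bent_cone s kap (2 * r) = M - Vz - Uz.
  by rewrite /bent_cone /s; field; rewrite gt_eqF.
pose pen := fun xy : 'rV[R]_d * 'rV[R]_d =>
  - (j * (enorm (xy.1 - xy.2) * enorm (xy.1 - xy.2))) -
  bent_cone s kap (enorm (xy.2 - z)).
have cpen : continuous pen.
  apply: continuous_add; apply: continuous_opp.
    apply: continuous_mul; first exact: continuous_cst.
    by apply: continuous_mul; exact: pair_distance_continuous.
  apply: continuous_compose (@bent_cone_continuous _ _) => xy.
  apply: (@cvg_comp _ _ _ snd (fun y => enorm (y - z))); first exact: cvg_snd.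
  exact: distance_continuous.
have K0 : K !=set0 by exists a.
have B0 : B !=set0 by exists z; rewrite /B /= subrr enorm0 ltW.
have cst0 : {within B, continuous (fun=> 0 : R)}.
  by apply: continuous_subspaceT => y; exact: cst_continuous.
have [] := max_pair K0 B0 cK (@compact_enorm_ball z (2 * r)) cf cst0 cpen.
move=> a0 [y0 [Ka0 By0 mx]].
have penE u y : pen (u, y) = - (j * dot (u - y) (u - y)) - bent_cone s kap (enorm (y - z)).
  by rewrite /pen /= -expr2 sqr_enorm.
have {}mx u y : K u -> enorm (y - z) <= 2 * r ->
    f u - j * dot (u - y) (u - y) - bent_cone s kap (enorm (y - z)) <=
    f a0 - j * dot (a0 - y0) (a0 - y0) - bent_cone s kap (enorm (y0 - z)).
  by move=> Ku By; have := mx u y Ku By; rewrite !penE !addr0 !addrA.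
suff main : f a0 - j * dot (a0 - y0) (a0 - y0) -
    bent_cone s kap (enorm (y0 - z)) <= Uz.
  have := mx x alpha Kx (_ : enorm (alpha - z) <= 2 * r).
  rewrite ralpha => /(_ _)/le_trans/(_ main); rewrite lerBlDr.
  have -> : Uz + bent_cone s kap r = (Uz + M - Vz) / 2 - kap / 2 * r ^+ 2.
    by rewrite /bent_cone /s; field; rewrite gt_eqF.
  by apply; rewrite mulr_natl mulr2n lerDl ltW.
have [->|kz] := eqVneq y0 z.
  by rewrite subrr enorm0 /bent_cone mulr0 expr0n mulr0 addr0 subr0; exact: HU.
pose k := y0 - z; have k0 : k != 0 by rewrite subr_eq0.
have [yT|yT] := eqVneq (enorm k) (2 * r).
  rewrite -/k yT sT.
  have := HM (xi := y0) (xi' := z) Ka0 KyV; rewrite -/k yT HV => /(_ (lexx _)).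
  lra.
have kT : enorm k < 2 * r by rewrite lt_neqAle yT.
exfalso.
have mx0 u : K u -> f u - j * dot (u - y0) (u - y0) <=
    f a0 - j * dot (a0 - y0) (a0 - y0).
  by move=> Ku; have := mx u y0 Ku (ltW kT); rewrite lerD2r.
have close := realiser_close Ka0 (ltW kT) mx0.
pose q := (2 * j) *: (a0 - y0).
have qp : enorm (q - j *: (a - b)) <= 2 * j * omega.
  rewrite (_ : q - _ = (2 * j) *: (a0 - y0 - 2^-1 *: (a - b))); last first.
    by apply/rowP => i; rewrite /q !mxE; field.
  have j2 : 0 < 2 * j by rewrite mulr_gt0.
  by rewrite enormZ (gtr0_norm j2) ler_pM2l.
have q0 : q != 0.
  apply/eqP => qz; move: qp; rewrite qz add0r enormN leNgt => /negP; apply.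
  exact: Hp.
have a0a : enorm (a0 - a) < tau.
  apply: le_lt_trans Htau.
  rewrite (_ : a0 - a = (a0 - y0 - 2^-1 *: (a - b)) + k); last first.
    by apply/rowP => i; rewrite /k /z !mxE; field.
  by apply: le_trans (enormD _ _) _; rewrite lerD // ltW.
have rad (h : 'rV[R]_d) : enorm h < 2 * r - enorm k -> enorm (y0 + h - z) <= 2 * r.
  move=> hr; rewrite addrAC; apply: le_trans (enormD _ _) _.
  by rewrite -lerBrDl ltW.
have kr : 0 < 2 * r - enorm k by rewrite subr_gt0.
have khE h : k + h = y0 + h - z by rewrite /k addrAC.
(* varying [y0] alone identifies the gradient of the cone as [q] *)
pose fy := fun y => - j * dot (a0 - y) (a0 - y).
have Hfy : exists2 r : R, 0 < r & forall h, enorm h < r ->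
    fy (y0 + h) - fy y0 <= bent_cone s kap (enorm (k + h)) - bent_cone s kap (enorm k).
  exists (2 * r - enorm k) => // h hr; have := mx a0 _ Ka0 (rad _ hr).
  rewrite khE /fy -/k; lra.
have gfy h : fy y0 + dot q h - j * dot h h <= fy (y0 + h).
  rewrite /fy /q opprD addrA; move: (a0 - y0) => u.
  rewrite !dotE (dotC h u); lra.
(* translating [a0] and [y0] together keeps the penalty constant, so the cone
   touches [f] at [a0] *)
have Hf : exists2 r : R, 0 < r & forall h, enorm h < r ->
    f (a0 + h) - f a0 <= bent_cone s kap (enorm (k + h)) - bent_cone s kap (enorm k).
  exists (Order.min (2 * r - enorm k) (tau - enorm (a0 - a))).
    by rewrite lt_min kr subr_gt0.
  move=> h; rewrite lt_min => /andP[hr ht].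
  have Kh : K (a0 + h).
    apply: KO; rewrite addrAC; apply: le_lt_trans (enormD _ _) _.
    by rewrite -ltrBrDl.
  have := mx _ _ Kh (rad _ hr).
  rewrite (_ : a0 + h - (y0 + h) = a0 - y0); last by rewrite opprD addrACA subrr addr0.
  rewrite khE -/k; lra.
have [c0|c0] := eqVneq (s + kap * enorm k) 0.
  have tf := radial_contact_flat k0 c0 Hfy.
  by have := touches_gradient tf gfy => /esym/eqP; rewrite (negbTE q0).
have [A' [B' [tfy _]]] := radial_contact k0 c0 Hfy.
have qE := touches_gradient tfy gfy.
have [A1 [B1 [tf kapE]]] := radial_contact k0 c0 Hf.
move: tf kapE; rewrite qE => tf kapE.
by have := Hcontact a0a qp tf; rewrite kapE ltxx.
Qed.

End SupConvolution.

End ConeComparison.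

(** * Doubling of variables *)

Section Doubling.
Variables (R : realType) (d : nat).
Implicit Types (f g : 'rV[R]_d -> R) (x y p q h : 'rV[R]_d).

(** The distance from [h] to the closed ball of radius [2 r]. *)
Definition excess (r : R) h : R := Order.max (enorm h - 2 * r) 0.

Lemma excess_ge0 (r : R) h : 0 <= excess r h.
Proof. by rewrite /excess le_max lexx orbT. Qed.

Lemma excess_le (r : R) h h' : enorm h' <= 2 * r -> excess r h <= enorm (h - h').
Proof.
move=> h'r; rewrite /excess ge_max enorm_ge0 andbT.
have := enorm_sub_le h h'; lra.
Qed.

Lemma excess_attained (r : R) h : 0 < r -> exists c : 'rV[R]_d,
  [/\ enorm c <= 2 * r, enorm (h - c) = excess r h & h - c != 0 -> enorm c = 2 * r].
Proof.
move=> r0; have [hr|hr] := leP (enorm h) (2 * r).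
  exists h; rewrite subrr enorm0 eqxx; split => //.
  by rewrite /excess; apply/esym/max_idPr; rewrite subr_le0.
have h0 : 0 < enorm h by apply: lt_trans hr; rewrite mulr_gt0.
exists ((2 * r / enorm h) *: h).
have nc : enorm ((2 * r / enorm h) *: h) = 2 * r.
  rewrite enormZ ger0_norm ?divfK ?gt_eqF //.
  by rewrite divr_ge0 ?mulr_ge0 ?ltW.
split; rewrite ?nc //.
rewrite -{1}[h]scale1r -scalerBl enormZ ger0_norm; last first.
  by rewrite subr_ge0 ler_pdivrMr // mul1r ltW.
rewrite /excess; have /max_idPl -> : 0 <= enorm h - 2 * r by rewrite subr_ge0 ltW.
by rewrite mulrBl mul1r divfK // gt_eqF.
Qed.

Lemma half_sqr_distance_le x y : 2^-1 * dot (x - y) (x - y) <= dot x x + dot y y.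
Proof. have := dotxx_ge0 (x + y); rewrite !dotE (dotC y x); lra. Qed.

(** The maximum of [f x + g y - (j / 2) (excess r (x - y))^2] is the maximum
over pairs of points no further apart than [2 r] of the sum of the two
sup-convolutions. *)
Lemma penalised_maximum (K : set 'rV[R]_d) f g (j r : R) :
  K !=set0 -> compact K -> {within K, continuous f} -> {within K, continuous g} ->
  0 < j -> 0 < r ->
  exists a b c : 'rV[R]_d,
  let M := f a + g b - j / 2 * dot (a - b - c) (a - b - c) in
  [/\ K a /\ K b,
      enorm c <= 2 * r,
      a - b - c != 0 -> enorm c = 2 * r &
      forall x y xi xi', K x -> K y -> enorm (xi - xi') <= 2 * r ->
        f x - j * dot (x - xi) (x - xi) + (g y - j * dot (y - xi') (y - xi')) <= M].
Proof.
move=> K0 cK cf cg j0 r0.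
pose pen := fun xy : 'rV[R]_d * 'rV[R]_d =>
  - (j / 2) * (excess r (xy.1 - xy.2) * excess r (xy.1 - xy.2)).
have cpen : continuous pen.
  have cE : continuous (fun xy : 'rV[R]_d * 'rV[R]_d => excess r (xy.1 - xy.2)).
    apply: (continuous_compose (g := fun t : R => Order.max (t - 2 * r) 0)).
      exact: pair_distance_continuous.
    move=> t; apply: (@continuous_max _ _ (fun t : R => t - 2 * r : R^o) (fun=> 0 : R^o)).
      by apply: cvgB; [exact: cvg_id|exact: cvg_cst].
    exact: cvg_cst.
  apply: continuous_mul; first exact: continuous_cst.
  exact: continuous_mul.
have [a [b [Ka Kb mx]]] := max_pair K0 K0 cK cK cf cg cpen.
have [c [cr ce c2]] := excess_attained (a - b) r0.
exists a, b, c; split => // x y xi xi' Kx Ky xir.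
have := mx x y Kx Ky; rewrite /pen /= -!expr2 -ce sqr_enorm.
have E1 := excess_le (x - y) xir.
have := @half_sqr_distance_le (x - xi) (y - xi').
rewrite (_ : x - xi - (y - xi') = x - y - (xi - xi')); last first.
  by apply/rowP => i; rewrite !mxE; ring.
rewrite -(sqr_enorm (x - y - _)) => H1 H2.
have : excess r (x - y) ^+ 2 <= enorm (x - y - (xi - xi')) ^+ 2.
  by rewrite ler_pXn2r ?nnegrE ?excess_ge0 ?enorm_ge0.
move: H1 H2; move: (dot (x - xi) _) (dot (y - xi') _) => u v.
move: (enorm _ ^+ 2) (excess _ _ ^+ 2) => w e H1 H2 H3.
have : j * (2^-1 * e) <= j * (u + v).
  by rewrite ler_pM2l //; lra.
lra.
Qed.

End Doubling.

Section Contradiction.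
Variables (R : realType) (d : nat) (Omega : set 'rV[R]_d).
Variable Lambda : 'rV[R]_d -> R -> 'rV[R]_d.
Implicit Types (f g : 'rV[R]_d -> R) (x y p q h : 'rV[R]_d).

Let K := closure Omega.

(** Phrased for the one-sided inequality that doubling of variables yields at
[a]; the bound [L] has to be independent of [C], which grows with the doubling
parameter. *)
Definition slope_bound (w0 L : R) f := forall a q (C : R),
  (forall y, enorm (y - a) < w0 -> Omega y) ->
  (forall x, K x -> f x <= f a + dot q (x - a) + C * dot (x - a) (x - a)) ->
  enorm q <= L.

(** Identifies the gradient of the penalty at a point [a0] that realises the
sup-convolution at [al]. *)
Lemma penalty_quadratic x a0 p (j : R) :
  let al := a0 - 2^-1 *: p in
  j * dot (x - al) (x - al) - j * dot (a0 - al) (a0 - al) =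
  dot (j *: p) (x - a0) + j * dot (x - a0) (x - a0).
Proof.
move=> al; have -> : x - al = (x - a0) + 2^-1 *: p.
  by apply/rowP => i; rewrite !mxE; ring.
have -> : a0 - al = 2^-1 *: p by apply/rowP => i; rewrite !mxE; ring.
move: (x - a0) => h; rewrite !dotE (dotC h p); lra.
Qed.

Lemma sq_le_excess (t u r : R) : 0 <= t -> 0 <= u -> 0 < r -> t - 2 * r <= u ->
  t ^+ 2 <= u ^+ 2 + 4 * r * t.
Proof.
move=> t0 u0 r0 H; have [tr|tr] := leP t (2 * r); first by nra.
have : (t - 2 * r) ^+ 2 <= u ^+ 2 by rewrite ler_pXn2r ?nnegrE //; lra.
nra.
Qed.

(** The doubling parameter [j] brings the two points within [e0] of each
other; then [om] bounds the spread of the gradients; the radius [r] is the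
smallest. *)
Lemma doubling_scales (w0 zeta eps C1 : R) : 0 < w0 -> 0 < zeta -> 0 < eps -> 0 < C1 ->
  exists e0 j om r : R,
  [/\ [/\ 0 < e0, 0 < j, 0 < om & 0 < r],
      [/\ 4 * e0 <= w0, 4 * e0 <= zeta, 4 * e0 <= 1 & 2 * C1 = j * e0 ^+ 2],
      [/\ 4 * om <= e0, 8 * j * om <= zeta, 16 * j * om <= eps & 8 * j * om <= 1] &
      9 * r <= om /\ 12 * r <= om ^+ 2].
Proof.
move=> w00 zeta0 eps0 C10.
pose e0 := Order.min w0 (Order.min zeta 1) / 4.
have e00 : 0 < e0 by rewrite divr_gt0 // !lt_min w00 zeta0 ltr01.
pose j := 2 * C1 / e0 ^+ 2.
have j0 : 0 < j by apply: divr_gt0; [exact: mulr_gt0|exact: exprn_gt0].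
have j8 : 0 < 8 * j by exact: mulr_gt0.
have j16 : 0 < 16 * j by exact: mulr_gt0.
pose om := Order.min (e0 / 4) (Order.min (zeta / (8 * j))
  (Order.min (eps / (16 * j)) (1 / (8 * j)))).
have om0 : 0 < om by rewrite !lt_min; apply/and4P; split; apply: divr_gt0.
exists e0, j, om, (Order.min (om / 9) (om ^+ 2 / 12)); split; split => //.
- by rewrite lt_min; apply/andP; split; apply: divr_gt0 => //; exact: exprn_gt0.
- by rewrite mulrC divfK ?pnatr_eq0 // ge_min lexx.
- by rewrite mulrC divfK ?pnatr_eq0 // !ge_min lexx ?orbT.
- by rewrite mulrC divfK ?pnatr_eq0 // !ge_min lexx ?orbT.
- by rewrite /j divfK // gt_eqF // exprn_gt0.
- by rewrite mulrC -ler_pdivlMr // ge_min lexx.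
- by rewrite mulrC -ler_pdivlMr // !ge_min lexx ?orbT.
- by rewrite mulrC -ler_pdivlMr // !ge_min lexx ?orbT.
- by rewrite mulrC -ler_pdivlMr // !ge_min lexx ?orbT.
- by rewrite mulrC -ler_pdivlMr // ge_min lexx.
- by rewrite mulrC -ler_pdivlMr // ge_min lexx orbT.
Qed.

Lemma doubling_contradiction f g (eps mu M0 C w0 L zeta : R) :
  compact K -> {within K, continuous f} -> {within K, continuous g} ->
  0 < eps -> 0 < mu -> 0 < w0 -> 0 < zeta ->
  subsolution_at_contact Omega Lambda f ->
  (forall x p A B, Omega x -> touches g x p A B ->
    eps <= enorm p /\ mu <= normalized Lambda x p A B) ->
  (exists2 x, K x & M0 <= f x + g x) ->
  (forall x y, K x -> K y -> f x + g y <= M0 + C) ->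
  (forall x y, K x -> K y -> enorm (x - y) < w0 ->
    M0 <= f x + g y -> forall y', enorm (y' - x) < w0 -> Omega y') ->
  slope_bound w0 L f ->
  (forall x x' p p', K x -> K x' ->
    eps / 2 <= enorm p <= L + 1 -> eps / 2 <= enorm p' <= L + 1 ->
    enorm (x - x') < zeta -> enorm (p - p') < zeta ->
    `|drift Lambda x p - drift Lambda x' p'| < mu / 4) ->
  False.
Proof.
move=> cK cf cg eps0 mu0 w00 zeta0 Hf Hg HM0 HC Hsep Hslope Hdrift.
pose C1 := `|C| + 1.
have C10 : 0 < C1 by rewrite ltr_wpDl.
have [e0 [j [om [r [[e00 j0 om0 r0] [e0w e0z e01 jE] [ome omz omeps om1] [r9 r12]]]]]] :=
  doubling_scales w00 zeta0 eps0 C10.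
have jom0 : 0 < j * om by rewrite mulr_gt0.
have jr : 9 * (j * r) <= j * om by rewrite mulrCA ler_pM2l.
have jr0 : 0 < j * r by rewrite mulr_gt0.
have [x1 Kx1 Mx1] := HM0.
have K0 : K !=set0 by exists x1.
have [a [b [c [[Ka Kb] cr c2 HM]]]] := penalised_maximum K0 cK cf cg j0 r0.
move: HM; set M := _ - _ => HM.
pose h := a - b; pose del := a - b - c.
have MM0 : M0 <= M.
  have := HM x1 x1 x1 x1 Kx1 Kx1; rewrite !subrr enorm0 !dot0r mulr0 !subr0.
  by move=> H; apply: le_trans Mx1 (H _); apply: mulr_ge0; rewrite ltW.
have dele : enorm del <= e0.
  rewrite -(@ler_pXn2r _ 2) ?nnegrE ?enorm_ge0 ?(ltW e00) // sqr_enorm.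
  have H1 : j / 2 * dot del del <= C1.
    have := HC _ _ Ka Kb; have := ler_norm C; move: MM0.
    by rewrite /M -/del /C1; clear; lra.
  have : j * dot del del <= j * e0 ^+ 2 by rewrite -jE; clear -H1; lra.
  by rewrite ler_pM2l.
have he : enorm h < 2 * e0.
  rewrite /h -[a - b](subrK c); apply: le_lt_trans (enormD _ _) _.
  rewrite -/del; clear -dele cr r9 ome om0; lra.
have Mab : M0 <= f a + g b.
  apply: le_trans MM0 _; rewrite /M gerBl.
  by apply: mulr_ge0; [rewrite divr_ge0 // ltW|exact: dotxx_ge0].
have hw : enorm (a - b) < w0 by rewrite -/h; clear -he e0w e00; lra.
have balla := Hsep _ _ Ka Kb hw Mab.
have ballb y : enorm (y - b) < 2 * e0 -> Omega y.
  move=> yb; apply: balla; apply: le_lt_trans (enormB_triangle b _ _) _.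
  rewrite (enormB b a) -/h; clear -yb he e0w; lra.
have Oa : Omega a by apply: balla; rewrite subrr enorm0.
have Ob : Omega b by apply: ballb; rewrite subrr enorm0 mulr_gt0.
have OK x : Omega x -> K x by exact: subset_closure.
(* [a] and [b] realise the sup-convolutions at [al] and [be], whose distance
   is exactly [2 r] since the penalty is active *)
pose al := a - 2^-1 *: del; pose be := b - 2^-1 *: (- del).
have alb : al - be = c.
  by apply/rowP => i; rewrite /al /be /del !mxE; field.
have valM : f a - j * dot (a - al) (a - al) + (g b - j * dot (b - be) (b - be)) = M.
  have -> : a - al = 2^-1 *: del by rewrite /al opprB addrC subrK.
  have -> : b - be = 2^-1 *: (- del) by rewrite /be opprB addrC subrK.
  rewrite /M -/del !dotE; clear; lra.
have fa x : K x -> f x <= f a + dot (j *: del) (x - a) + j * dot (x - a) (x - a).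
  move=> Kx; have := HM x b al be Kx Kb; rewrite alb => /(_ cr).
  rewrite -valM lerD2r; have := penalty_quadratic x a del j; rewrite /= -/al; clear; lra.
have gb x : K x -> g x <= g b + dot (j *: - del) (x - b) + j * dot (x - b) (x - b).
  move=> Kx; have := HM a x al be Ka Kx; rewrite alb => /(_ cr).
  rewrite -valM lerD2l; have := penalty_quadratic x b (- del) j; rewrite /= -/be; clear; lra.
pose p := j *: del.
have pL : enorm p <= L by exact: Hslope _ _ _ balla fa.
have peps : eps <= enorm p.
  have tg : touches g b (j *: - del) j 0.
    move=> eta eta0; exists (2 * e0); first by rewrite mulr_gt0.
    move=> k kr; have := gb (b + k); rewrite (addrC b) addrK => /(_ _)/le_trans; apply.
      by apply: OK; apply: ballb; rewrite addrK.
    rewrite mul0r addr0 mulrDl addrA lerDl.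
    by apply: mulr_ge0; [exact: ltW|exact: dotxx_ge0].
  by have [] := Hg _ _ _ _ Ob tg; rewrite scalerN enormN.
have del0 : del != 0.
  by apply/eqP => d0; move: peps; rewrite /p d0 scaler0 enorm0 leNgt eps0.
have cE := c2 del0.
have pjh : enorm (p - j *: h) <= 2 * (j * r).
  rewrite /p /del -/h -scalerBr addrAC subrr sub0r enormZ enormN gtr0_norm //.
  by rewrite mulrCA ler_pM2l.
(* [realiser_close] confines the contact gradients to this ball, where
   [Hdrift] freezes the drift up to [mu / 4] *)
have gapE q : enorm (q - j *: h) <= 2 * j * om ->
    [/\ eps / 2 <= enorm q <= L + 1, enorm (q - p) < zeta & q != 0].
  move=> qh.
  have qp : enorm (q - p) <= 2 * (j * om) + 2 * (j * r).
    by apply: le_trans (enormB_triangle (j *: h) _ _) _; rewrite (enormB _ p) lerD // mulrA.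
  have q1 : enorm q <= L + 1.
    have := enorm_sub_le q p; clear -qp pL om1 jr jr0; lra.
  have q2 : eps / 2 <= enorm q.
    have := enorm_sub_le p q; rewrite (enormB p); clear -qp peps omeps jr jr0 eps0; lra.
  split; [by rewrite q1 q2|clear -qp omz jr jr0 zeta0; lra|].
  by apply/eqP => qz; move: q2; rewrite qz enorm0 leNgt divr_gt0.
have pin : eps / 2 <= enorm p <= L + 1.
  by apply/andP; clear -pL peps eps0; split; lra.
have Hp : 2 * j * om < enorm (j *: h).
  have := enorm_sub_le p (j *: h); clear -pjh peps omeps jr jr0 eps0 jom0; lra.
pose kapf := - drift Lambda a p - mu / 4.
pose kapg := drift Lambda a p + 3 * mu / 4.
have Hcf x q A B : enorm (x - a) < 2 * e0 -> enorm (q - j *: h) <= 2 * j * om ->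
    touches f x q A B -> kapf < 2 * A + 2 * B * dot q q.
  move=> xa qh tf; have [qin qz q0] := gapE q qh.
  have Ox : Omega x by apply: balla; clear -xa e0w e00; lra.
  have xz : enorm (x - a) < zeta by clear -xa e0z e00; lra.
  have := Hf _ _ _ _ Ox tf q0; rewrite /normalized.
  have := Hdrift _ _ _ _ (OK _ Ox) Ka qin pin xz qz.
  by move=> /ltr_normlP [_]; rewrite /kapf; clear; lra.
have Hcg x q A B : enorm (x - b) < 2 * e0 -> enorm (q - j *: (b - a)) <= 2 * j * om ->
    touches g x q A B -> kapg < 2 * A + 2 * B * dot q q.
  move=> xb qh tg.
  have qh' : enorm (- q - j *: h) <= 2 * j * om.
    rewrite (_ : - q - j *: h = - (q - j *: (b - a))) ?enormN //.
    by apply/rowP => i; rewrite /h !mxE; ring.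
  have [qin qz _] := gapE _ qh'.
  have Ox : Omega x by exact: ballb.
  have [_] := Hg _ _ _ _ Ox tg; rewrite /normalized.
  have xa : enorm (x - a) < zeta.
    apply: le_lt_trans (enormB_triangle b _ _) _; rewrite (enormB b a) -/h; clear -xb he e0z; lra.
  have := Hdrift _ _ _ _ (OK _ Ox) Ka qin pin xa qz.
  move=> /ltr_normlP [+ _]; rewrite driftN /kapg; clear; lra.
have HMg x y xi xi' : K x -> K y -> enorm (xi - xi') <= 2 * r ->
    g x - j * dot (x - xi) (x - xi) + (f y - j * dot (y - xi') (y - xi')) <= M.
  by move=> Kx Ky xr; rewrite addrC; apply: HM => //; rewrite enormB.
pose D := 2 * j * r.
have HD : M - D <= f a + g b - j / 2 * dot (a - b) (a - b).
  rewrite /M -/del -/h -!sqr_enorm.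
  have := enorm_sub_le h c; rewrite -/(a - b - c) -/del cE => H1.
  have hd := enorm_ge0 del.
  have h1 : enorm h <= 1 by clear -he e01; lra.
  have h0 := enorm_ge0 h.
  have : enorm h ^+ 2 - enorm del ^+ 2 <= 4 * r.
    have H2 := sq_le_excess h0 hd r0 H1.
    have : 4 * r * enorm h <= 4 * r by rewrite ger_pMr // mulr_gt0.
    clear -H2; lra.
  move=> H2; have : j / 2 * (enorm h ^+ 2 - enorm del ^+ 2) <= j / 2 * (4 * r).
    by rewrite ler_pM2l // divr_gt0.
  by rewrite /D; clear; lra.
have HDg : M - D <= g b + f a - j / 2 * dot (b - a) (b - a).
  by rewrite -(opprB a b) dotNl dotNr opprK (addrC (g b)).
have Hom : 3 * D / j + 36 * r ^+ 2 <= om ^+ 2.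
  rewrite (_ : 3 * D / j = 6 * r); last by rewrite /D; field; rewrite gt_eqF.
  have : 81 * r ^+ 2 <= om ^+ 2.
    rewrite (_ : 81 * r ^+ 2 = (9 * r) ^+ 2); last by ring.
    by rewrite ler_pXn2r ?nnegrE ?mulr_ge0 ?(ltW r0) ?(ltW om0).
  have := sqr_ge0 om; clear -r12; lra.
have Htau : om + 2 * r < 2 * e0 by clear -ome r9 om0 e00; lra.
have KOa x : enorm (x - a) < 2 * e0 -> K x.
  by move=> xa; apply: OK; apply: balla; clear -xa e0w e00; lra.
have KOb x : enorm (x - b) < 2 * e0 -> K x by move=> xb; exact/OK/ballb.
pose z := 2^-1 *: (a + b).
have cpen : continuous (fun x => - (j * (enorm (x - z) * enorm (x - z)))).
  apply: continuous_opp; apply: continuous_mul; first exact: continuous_cst.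
  by apply: continuous_mul; exact: distance_continuous.
have [xf Kxf mxf] := max_one K0 cK cf cpen.
have [xg Kxg mxg] := max_one K0 cK cg cpen.
have mxf' x' : K x' -> f x' - j * dot (x' - z) (x' - z) <= f xf - j * dot (xf - z) (xf - z).
  by move=> Kx; rewrite -!sqr_enorm !expr2; exact: mxf.
have mxg' x' : K x' -> g x' - j * dot (x' - z) (x' - z) <= g xg - j * dot (xg - z) (xg - z).
  by move=> Kx; rewrite -!sqr_enorm !expr2; exact: mxg.
have alz : enorm (al - z) = r.
  rewrite (_ : al - z = 2^-1 *: c); last first.
    by apply/rowP => i; rewrite /al /z /del !mxE; field.
  by rewrite enormZ cE ger0_norm // mulrA mulVf ?mul1r ?pnatr_eq0.
have bez : enorm (be - z) = r.
  rewrite (_ : be - z = - (2^-1 *: c)); last first.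
    by apply/rowP => i; rewrite /be /z /del !mxE; field.
  by rewrite enormN enormZ cE ger0_norm // mulrA mulVf ?mul1r ?pnatr_eq0.
have b1 := half_way_bound cK cf j0 r0 (ltW om0) Ka Kb HM HD Hom Hp Htau KOa Hcf mxf'
  (ex_intro2 _ _ xg Kxg erefl) alz Ka.
have zE : 2^-1 *: (b + a) = z by rewrite addrC.
have Hpg : 2 * j * om < enorm (j *: (b - a)).
  by rewrite -(opprB a b) scalerN enormN.
have b2 := half_way_bound cK cg j0 r0 (ltW om0) Kb Ka HMg HDg Hom Hpg Htau KOb Hcg.
move: b2; rewrite zE => b2.
have {}b2 := b2 _ _ _ _ mxg' (ex_intro2 _ _ xf Kxf erefl) bez Kb.
have : mu / 4 * r ^+ 2 <= 0.
  move: b1 b2 valM; rewrite /kapf /kapg; clear; lra.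
by rewrite leNgt mulr_gt0 ?divr_gt0 ?exprn_gt0.
Qed.

End Contradiction.

(** * Composition with a function of one variable *)

Section ChainRule.
Variables (R : realType) (d : nat).
Implicit Types (f : 'rV[R]_d -> R) (x p q h : 'rV[R]_d).

(** The chain rule for contact. Since [G] is increasing, contact of [G (f y)]
from above gives contact of [f] by applying the inverse of [G], and for this
only a lower bound on [G] near [f x] matters. *)
Lemma touches_comp f (G : R -> R) x q (A B G1 G2 : R) : 0 < G1 ->
  {mono G : s t / s <= t} ->
  (forall eta : R, 0 < eta -> exists2 e : R, 0 < e & forall t, `|t| < e ->
    G (f x) + G1 * t + (G2 / 2 - eta) * t ^+ 2 <= G (f x + t)) ->
  touches (fun y => G (f y)) x q A B ->
  touches f x (G1^-1 *: q) (A / G1) (B * G1 - G2 / (2 * G1)).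
Proof.
move=> G10 mG HG tW eta eta0.
set p := G1^-1 *: q; set A' := A / G1; set B' := _ - _.
have qE : q = G1 *: p by rewrite /p scalerA divff ?scale1r ?gt_eqF.
have np := enorm_ge0 p.
pose C := `|A'| + eta + `|B'| * dot p p.
have C0 : 0 <= C by rewrite !addr_ge0 ?mulr_ge0 ?dotxx_ge0 // ltW.
pose P := enorm p + C + 1.
have P0 : 0 < P by rewrite /P; lra.
have Ge : 0 < G1 * eta / 4 by rewrite divr_gt0 ?mulr_gt0.
have [e3 e30 He3] := HG (G1 * eta / 4 / P ^+ 2) (divr_gt0 Ge (exprn_gt0 2 P0)).
have [r r0 Hr] := tW (G1 * eta / 4) Ge.
pose S := `|G2| * C * P + 1.
have S0 : 0 < S by rewrite /S ltr_wpDl // !mulr_ge0 // ltW.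
exists (Order.min r (Order.min 1 (Order.min (e3 / P) (G1 * eta / 4 / S)))).
  by rewrite !lt_min r0 ltr01 /=; apply/andP; split; apply: divr_gt0.
move=> h; rewrite !lt_min => /and4P[hr h1 he hS].
have nh := enorm_ge0 h.
rewrite ltr_pdivlMr // in he; rewrite ltr_pdivlMr // in hS.
have := Hr _ hr; rewrite qE dotZl => HQ.
pose rem := (A' + eta) * dot h h + B' * dot p h ^+ 2.
pose ts := dot p h + rem.
have ph : `|dot p h| <= enorm p * enorm h by exact: ler_abs_dot.
have hh0 : 0 <= dot h h by exact: dotxx_ge0.
have phsq : dot p h ^+ 2 <= dot p p * dot h h.
  rewrite -!sqr_enorm -exprMn -[X in X <= _]real_normK ?num_real //.
  by rewrite ler_pXn2r ?nnegrE ?mulr_ge0.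
have remC : `|rem| <= C * dot h h.
  apply: le_trans (ler_normD _ _) _; rewrite (normrM (A' + eta)) (normrM B') (ger0_norm hh0).
  rewrite (ger0_norm (sqr_ge0 _)) /C mulrDl lerD //.
    rewrite ler_wpM2r //; apply: le_trans (ler_normD _ _) _.
    by rewrite (gtr0_norm eta0).
  by rewrite -mulrA ler_wpM2l.
have hh1 : dot h h <= enorm h by rewrite -sqr_enorm; nra.
have tsP : `|ts| <= P * enorm h.
  apply: le_trans (ler_normD _ _) _.
  have : C * dot h h <= C * enorm h by rewrite ler_wpM2l.
  rewrite /P; nra.
have tse : `|ts| < e3 by apply: le_lt_trans tsP _; rewrite mulrC.
have := He3 _ tse => HGt.
have ts2 : ts ^+ 2 <= P ^+ 2 * dot h h.
  rewrite -sqr_enorm -exprMn -[X in X <= _]real_normK ?num_real //.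
  by rewrite ler_pXn2r ?nnegrE ?mulr_ge0 // ltW.
have key : G2 / 2 * (dot p h ^+ 2 - ts ^+ 2) <= G1 * eta / 4 * dot h h.
  apply: le_trans (ler_norm _) _; rewrite normrM.
  have -> : dot p h ^+ 2 - ts ^+ 2 = - (rem * (2 * dot p h + rem)) by rewrite /ts; ring.
  have b1 : `|2 * dot p h + rem| <= 2 * P * enorm h.
    apply: le_trans (ler_normD _ _) _; rewrite normrM ger0_norm //.
    have : C * dot h h <= C * enorm h by rewrite ler_wpM2l.
    move: remC ph; rewrite /P; nra.
  have b2 : `|rem * (2 * dot p h + rem)| <= C * dot h h * (2 * P * enorm h).
    by rewrite normrM ler_pM.
  rewrite normrN.
  apply: (@le_trans _ _ (`|G2 / 2| * (C * dot h h * (2 * P * enorm h)))).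
    by rewrite ler_wpM2l.
  rewrite normrM (ger0_norm (_ : 0 <= 2^-1)) //.
  rewrite (_ : _ * _ = (`|G2| * C * P) * enorm h * dot h h); last first.
    by move: `|G2| => g; field.
  rewrite ler_wpM2r //; move: hS; rewrite /S mulrDr mulr1 mulrC; lra.
have key2 : G1 * eta / 4 / P ^+ 2 * ts ^+ 2 <= G1 * eta / 4 * dot h h.
  rewrite -(mulrA (_ / _)) ler_pM2l // mulrC ler_pdivrMr ?exprn_gt0 // mulrC.
  exact: ts2.
rewrite -!addrA [_ + (_ + _)](_ : _ = f x + ts); last by rewrite /ts /rem.
rewrite -mG; apply: le_trans HGt.
apply: le_trans HQ _.
have GB : B * (G1 * dot p h) ^+ 2 = G1 * (B' * dot p h ^+ 2) + G2 / 2 * dot p h ^+ 2.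
  by rewrite /B'; field; rewrite gt_eqF.
have GA : A * dot h h = G1 * (A' * dot h h) by rewrite /A'; field; rewrite gt_eqF.
have Gts : G1 * ts = G1 * dot p h + G1 * (A' * dot h h) + G1 * eta * dot h h
    + G1 * (B' * dot p h ^+ 2) by rewrite /ts /rem; ring.
have E0 := mulr_ge0 (ltW (mulr_gt0 G10 eta0)) hh0.
rewrite GB mulrDl GA Gts; lra.
Qed.

End ChainRule.

Section Exponential.
Variable R : realType.

(** The loss [eta] is necessary: for [t < 0] the exponential lies below its
quadratic Taylor polynomial. *)
Lemma expR_quadratic_lb (eta : R) : 0 < eta -> exists2 e : R, 0 < e &
  forall t, `|t| < e -> 1 + t + (2^-1 - eta) * t ^+ 2 <= expR t.
Proof.
move=> eta0; set c := 2^-1 - eta.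
have [c0|c0] := leP c 0.
  exists 1 => // t _; apply: le_trans (expR_ge1Dx t).
  by rewrite gerDl mulr_le0_ge0 // sqr_ge0.
have e0 : 0 < (1 - 2 * c) / (2 * c).
  by rewrite divr_gt0 ?mulr_gt0 // /c; lra.
exists ((1 - 2 * c) / (2 * c)) => // t; rewrite ltr_pdivlMr ?mulr_gt0 // => te.
pose F := fun s : R => expR s - (1 + s + c * s ^+ 2).
have dF (s : R) : is_derive s (1 : R) F (expR s - (1 + 2 * c * s)).
  have HX : is_derive s (1 : R) (fun u : R => u ^+ 2) (2 * s ^+ 1 *: 1).
    exact: (is_deriveX 2 (is_derive_id s (1 : R))).
  have H : is_derive s (1 : R) F (expR s - (0 + 1 + c *: (2 * s ^+ 1 *: 1))).
    apply: is_deriveB; apply: is_deriveD; exact: is_deriveZ.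
  apply: is_derive_eq H _; rewrite -![_ *: _]/(_ * _) expr1; ring.
have cF : continuous F.
  by move=> s; apply/differentiable_continuous/derivable1_diffP/ex_derive.
have F0 : F 0 = 0 by rewrite /F expR0 expr0n mulr0 !addr0 subrr.
rewrite -subr_ge0 -/(F t).
have F' s : derive1 F s = expR s - (1 + 2 * c * s).
  by rewrite derive1E; have H := dF s; exact: derive_val.
have dvF (s : R) : derivable F s 1 by have H := dF s; exact: ex_derive.
have wF (A : set R) : {within A, continuous F} by exact: continuous_subspaceT.
have [t0|t0] := leP 0 t.
  rewrite -F0.
  apply: (ger0_derive1_ndecr (fun s _ => dvF s) _ (wF _) (lexx 0) t0 (lexx t)).
  move=> s; rewrite in_itv /= => /andP[s0 _]; rewrite F'.
  have := expR_ge1Dx s; have : c < 2^-1 by rewrite /c; lra.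
  nra.
rewrite -F0.
apply: (ler0_derive1_nincr (fun s _ => dvF s) _ (wF _) (lexx t) (ltW t0) (lexx 0)).
move=> s; rewrite in_itv /= => /andP[ts s0]; rewrite F' subr_le0.
have := expR_ge1Dx (- s); rewrite expRN => H.
have s1 : 0 < 1 - s by lra.
have : expR s <= (1 - s)^-1.
  by rewrite -[expR s]invrK lef_pV2 ?posrE ?invr_gt0 ?expR_gt0.
move=> /le_trans; apply; rewrite -div1r ler_pdivrMr //.
have : - s * (2 * c) <= 1 - 2 * c.
  apply: le_trans (ltW te); rewrite ler_pM2r ?mulr_gt0 //.
  by rewrite (ltr0_norm t0) lerN2 ltW.
nra.
Qed.

End Exponential.

(** * Perturbation to a strict subsolution *)

Section Steepen.
Variables (R : realType) (d : nat) (Omega : set 'rV[R]_d).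
Variable Lambda : 'rV[R]_d -> R -> 'rV[R]_d.
Variables (eps lambda eta E0 : R) (V : 'rV[R]_d -> R).
Implicit Types (x p : 'rV[R]_d).

Hypotheses (eps0 : 0 < eps) (lambda0 : 0 < lambda) (eta0 : 0 < eta).
Hypothesis Theta_lip : forall (a : R) x (s : R), 1 < a < 2 -> closure Omega x -> 0 < s ->
  enorm ((a * s)^-1 *: Lambda x (a * s) - s^-1 *: Lambda x s) <= lambda * `|a - 1|.
Hypothesis HV : steep_subsolution_at_contact Omega Lambda eps V.

Let k := (2 * lambda + 1) / eps.

(** The exponential makes the second derivative a constant multiple [k] of the
amount by which the first derivative exceeds [1]. *)
Definition steepen (t : R) : R := t + eta / k * expR (k * t).

Hypothesis HE0 : forall x, Omega x -> E0 <= expR (k * V x).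
Hypothesis HE1 : forall x, Omega x -> eta * expR (k * V x) < 1.

Let k0 : 0 < k.
Proof. by rewrite divr_gt0 // addr_gt0 // mulr_gt0. Qed.

Lemma steepen_mono : {mono steepen : s t / s <= t}.
Proof.
have ek : 0 < eta / k by exact: divr_gt0.
apply: le_mono => s t st; rewrite /steepen ltrD // ltr_pM2l //.
by rewrite ltr_expR ltr_pM2l.
Qed.

Lemma steepen_expansion t0 : let E := expR (k * t0) in
  forall e : R, 0 < e -> exists2 r : R, 0 < r & forall t, `|t| < r ->
    steepen t0 + (1 + eta * E) * t + (eta * k * E / 2 - e) * t ^+ 2 <=
    steepen (t0 + t).
Proof.
move=> E e e0; have EE : 0 < E by exact: expR_gt0.
have ekE : 0 < eta * k * E by exact: mulr_gt0 (mulr_gt0 eta0 k0) EE.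
have [r r0 Hr] := expR_quadratic_lb (divr_gt0 e0 ekE).
exists (r / k); first exact: divr_gt0.
move=> t; rewrite ltr_pdivlMr // => tr.
have tr' : `|k * t| < r by rewrite normrM (gtr0_norm k0) mulrC.
have H := Hr _ tr'.
rewrite /steepen mulrDr expRD -/E.
have ekE2 : 0 < eta / k * E by exact: mulr_gt0 (divr_gt0 eta0 k0) EE.
rewrite -(ler_pM2l ekE2) in H.
have kn0 : k != 0 by rewrite gt_eqF.
have En0 : E != 0 by rewrite gt_eqF.
have etan0 : eta != 0 by rewrite gt_eqF.
have {}H : eta / k * E + eta * E * t + (eta * k * E / 2 - e) * t ^+ 2 <=
    eta / k * (E * expR (k * t)).
  rewrite [leRHS]mulrA; apply: le_trans H.
  by rewrite le_eqVlt; apply/orP; left; apply/eqP; field; rewrite etan0 kn0 En0.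
lra.
Qed.

Lemma drift_dilation x p (a : R) : 1 < a < 2 -> closure Omega x -> p != 0 ->
  - (a * lambda * (a - 1) * enorm p) <=
  drift Lambda x (a *: p) - a * drift Lambda x p.
Proof.
move=> a12 Kx p0; have np := enorm_gt0 p0; have /andP[a1 a2] := a12.
have a0 : 0 < a by lra.
have := Theta_lip a12 Kx np; rewrite gtr0_norm ?subr_gt0 // => H.
rewrite /drift enormZ gtr0_norm // dotZr.
set T := _ - _ in H.
have -> : a * dot (Lambda x (a * enorm p)) p / (a * enorm p) -
    a * (dot (Lambda x (enorm p)) p / enorm p) = a * dot T p.
  by rewrite /T !dotE; field; rewrite !gt_eqF.
rewrite -!mulrA -mulrN ler_pM2l // lerNl.
apply: le_trans (ler_norm _) _; rewrite normrN.
apply: le_trans (ler_abs_dot _ _) _.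
by rewrite mulrA ler_wpM2r // ltW.
Qed.

(** Composition with [steepen] adds [G'' |p|^2] to the second-order part and
dilates the gradient by [G' = 1 + eta E]; the latter perturbs the drift by at
most [lambda G' (G' - 1) |p|]. The rate [k] makes [G'' = k (G' - 1)] win
as soon as [|p| >= eps]. *)
Lemma steepen_strict x q A B : Omega x -> touches (fun y => steepen (V y)) x q A B ->
  eps <= enorm q /\ eps * eta * E0 <= normalized Lambda x q A B.
Proof.
move=> Ox tW; have Kx : closure Omega x by exact: subset_closure.
pose E := expR (k * V x); have EE : 0 < E by exact: expR_gt0.
pose G1 := 1 + eta * E; pose G2 := eta * k * E.
have eE : 0 < eta * E by exact: mulr_gt0.
have G12 : 1 < G1 < 2.
  by have := HE1 Ox; rewrite -/E /G1 => H; apply/andP; split; lra.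
have G10 : 0 < G1 by rewrite /G1; lra.
have := touches_comp G10 steepen_mono (@steepen_expansion (V x)) tW.
set p := G1^-1 *: q => tV; have [ep Hn] := HV Ox tV.
have qE : q = G1 *: p by rewrite /p scalerA divff ?scale1r ?gt_eqF.
have p0 : p != 0.
  by apply/eqP => pz; move: ep; rewrite pz enorm0 leNgt eps0.
have Gp : enorm p <= G1 * enorm p.
  rewrite ler_peMl ?enorm_ge0 //; lra.
split; first by rewrite qE enormZ gtr0_norm //; apply: le_trans Gp.
have := drift_dilation G12 Kx p0; rewrite -qE => Hd.
have [n0 kp] : 0 < enorm p /\ 2 * lambda + 1 <= k * enorm p.
  split; first exact: enorm_gt0.
  have l21 : 0 < 2 * lambda + 1 by rewrite addr_gt0 // mulr_gt0.
  by rewrite /k mulrAC ler_pdivlMr // ler_pM2l.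
have Hn' : 0 <= G1 * normalized Lambda x p (A / G1) (B * G1 - G2 / (2 * G1)).
  by rewrite mulr_ge0 // ltW.
have E1 : normalized Lambda x q A B =
  G1 * normalized Lambda x p (A / G1) (B * G1 - G2 / (2 * G1)) +
  G2 * dot p p + (drift Lambda x q - G1 * drift Lambda x p).
  by rewrite /normalized qE !dotE; field; rewrite gt_eqF.
rewrite E1 -sqr_enorm.
have E2 : eps * eta * E0 <= eta * E * enorm p.
  rewrite -mulrA mulrC -[leRHS]mulrC; apply: le_trans (_ : eps * (eta * E) <= _).
    by rewrite mulrC ler_pM2l // ler_pM2l // HE0.
  by rewrite ler_pM2r.
have E3 : 0 <= eta * E * enorm p * (k * enorm p - G1 * lambda - 1).
  apply: mulr_ge0; first exact: mulr_ge0 (ltW eE) (enorm_ge0 p).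
  have : G1 * lambda <= 2 * lambda by rewrite ler_pM2r //; lra.
  lra.
move: Hd; rewrite (_ : G1 - 1 = eta * E); last by rewrite /G1; ring.
rewrite /G2; lra.
Qed.

End Steepen.

(** * Local Lipschitz bound *)

Section Slope.
Variables (R : realType) (d : nat) (Omega : set 'rV[R]_d).
Variable Lambda : 'rV[R]_d -> R -> 'rV[R]_d.
Variables (lambda : R) (f : 'rV[R]_d -> R).
Implicit Types (x y p q a : 'rV[R]_d).

Let K := closure Omega.
Hypothesis lambda0 : 0 < lambda.
Hypothesis Theta_lip : forall (a : R) x (s : R), 1 < a < 2 -> K x -> 0 < s ->
  enorm ((a * s)^-1 *: Lambda x (a * s) - s^-1 *: Lambda x s) <= lambda * `|a - 1|.
Hypothesis Lambda_lim : forall e : R, 0 < e ->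
  \forall s \near (0 : R)^'+, forall x, K x -> enorm (s ^+ 2 *: Lambda x s) < e.

Lemma bernoulli_half (m : nat) : 1 + m%:R / 2 <= (3 / 2 : R) ^+ m.
Proof.
elim: m => [|m IH]; first by rewrite mul0r addr0 expr0.
rewrite exprS -(natr1 m); have : 0 <= m%:R :> R by [].
lra.
Qed.

(** Each dilation by [3 / 2] changes [Theta] by at most [lambda / 2], so
[Theta] grows at most logarithmically; a reference scale [s0] comes from the
behaviour of [Lambda] at [0]. *)
Lemma Theta_log_growth : exists s0 C0 : R, [/\ 0 < s0, 0 <= C0 &
  forall (k : nat) x, K x -> let s := (3 / 2) ^+ k * s0 in
    enorm (s^-1 *: Lambda x s) <= C0 + k%:R * (lambda / 2)].
Proof.
have [s0 [s00 Hs0]] : exists s0 : R, 0 < s0 /\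
    forall x, K x -> enorm (s0 ^+ 2 *: Lambda x s0) < 1.
  near (0 : R)^'+ => s; exists s; split.
    by near: s; exact: nbhs_right_gt.
  by near: s; exact: Lambda_lim.
exists s0, (s0 ^- 3); split => //; first by rewrite invr_ge0 exprn_ge0 // ltW.
elim=> [|k IH] x Kx /=.
  rewrite expr0 mul1r mul0r addr0.
  have -> : s0^-1 *: Lambda x s0 = s0 ^- 3 *: (s0 ^+ 2 *: Lambda x s0).
    by rewrite scalerA; congr (_ *: _); field; rewrite gt_eqF.
  rewrite enormZ ger0_norm ?invr_ge0 ?exprn_ge0 ?(ltW s00) //.
  rewrite ler_piMr ?invr_ge0 ?exprn_ge0 ?(ltW s00) //.
  by apply/ltW/Hs0.
have a12 : 1 < (3 / 2 : R) < 2 by apply/andP; split; lra.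
have s1 : 0 < (3 / 2 : R) ^+ k * s0 by rewrite mulr_gt0 // exprn_gt0.
have eS : 3 / 2 * ((3 / 2) ^+ k * s0) = (3 / 2) ^+ k.+1 * s0.
  by rewrite exprS mulrA.
have := Theta_lip a12 Kx s1; have := IH x Kx; rewrite /= eS.
rewrite (_ : 3 / 2 - 1 = 2^-1 :> R); last by field.
rewrite ger0_norm // => H1 H2.
have := enorm_sub_le (((3 / 2) ^+ k.+1 * s0)^-1 *: Lambda x ((3 / 2) ^+ k.+1 * s0))
  (((3 / 2) ^+ k * s0)^-1 *: Lambda x ((3 / 2) ^+ k * s0)).
rewrite -(natr1 k); lra.
Unshelve. all: by end_near.
Qed.

(** A cone with slope [B] at its vertex and second derivative [- B N] rises to
a height comparable to [B / N] over a distance [1 / (2 N)]. Since [Theta] grows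
more slowly than linearly, this height can be made to exceed any bound while the
bending still dominates the drift. *)
Lemma Lambda_growth (T : R) : 0 < T -> exists B N : R,
  [/\ 0 < N, T <= B, T * N <= B &
  forall x s, K x -> B / 2 < s < B -> enorm (Lambda x s) < B * N].
Proof.
move=> T0; have [s0 [C0 [s00 C00 H]]] := Theta_log_growth.
pose al := 1 + C0 + lambda; have al0 : 0 < al by rewrite /al; have := lambda0; lra.
(* [B] is at least [m^2 s0 / 4] by Bernoulli's inequality, while [N] is affine
   in [m] *)
pose m := (Num.truncn (4 * T * (al + lambda + 1) / s0)).+1.
have mgt : 4 * T * (al + lambda + 1) < m%:R * s0.
  rewrite -ltr_pdivrMr //; exact: truncnS_gt.
have m1 : 1 <= m%:R :> R by rewrite ler1n.
pose B := (3 / 2 : R) ^+ (2 * m) * s0.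
pose N := al + m%:R * lambda.
have Bm : m%:R ^+ 2 / 4 * s0 <= B.
  rewrite ler_pM2r // mulnC exprM.
  have -> : m%:R ^+ 2 / 4 = (m%:R / 2) ^+ 2 :> R by field.
  have := bernoulli_half m => Hb.
  have p0 : 0 <= (3 / 2 : R) ^+ m by exact: exprn_ge0.
  have m0 : 0 <= m%:R / 2 :> R by lra.
  by rewrite ler_pXn2r ?nnegrE //; lra.
have B0 : 0 < B by rewrite mulr_gt0 // exprn_gt0.
have l0 := lambda0.
have TN : T * (al + m%:R * lambda + m%:R) <= B.
  apply: le_trans Bm.
  have : T * (al + m%:R * lambda + m%:R) <= T * (m%:R * (al + lambda + 1)).
    rewrite ler_pM2l //; nra.
  have : m%:R * (4 * T * (al + lambda + 1)) <= m%:R * (m%:R * s0).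
    by rewrite ler_pM2l ?(ltW mgt) //; lra.
  lra.
have mR : 0 <= m%:R * lambda by rewrite mulr_ge0 // ltW.
exists B, N; split.
- rewrite /N; lra.
- apply: le_trans TN; rewrite ler_peMr // /al; lra.
- by apply: le_trans TN; rewrite ler_pM2l // /N lerDl.
move=> x s Kx /andP[s1 s2].
have sp : 0 < s by lra.
have a12 : 1 < B / s < 2.
  by rewrite ltr_pdivlMr // ltr_pdivrMr //; apply/andP; split; lra.
have sB : B / s * s = B by rewrite divfK // gt_eqF.
have /= HB := H (2 * m)%N x Kx; rewrite -/B natrM in HB.
have := Theta_lip a12 Kx sp; rewrite sB gtr0_norm; last by lra.
move=> H1.
have H2 : lambda * (B / s - 1) <= lambda by rewrite ger_pMr //; lra.
have : enorm (s^-1 *: Lambda x s) < N.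
  have := enorm_sub_le (s^-1 *: Lambda x s) (B^-1 *: Lambda x B).
  rewrite (enormB _ (B^-1 *: _)) /N /al; lra.
rewrite enormZ gtr0_norm ?invr_gt0 // mulrC ltr_pdivrMr //.
move=> /lt_le_trans; apply; rewrite mulrC ler_pM2r; first exact: ltW.
by rewrite /N; lra.
Qed.

Lemma drift_le x p : `|drift Lambda x p| <= enorm (Lambda x (enorm p)).
Proof.
have [->|p0] := eqVneq p 0.
  by rewrite /drift dot0r mul0r normr0 enorm_ge0.
have np := enorm_gt0 p0.
by rewrite /drift normrM normfV (gtr0_norm np) ler_pdivrMr // ler_abs_dot.
Qed.

Hypothesis cf : {within K, continuous f}.
Hypothesis Hf : subsolution_at_contact Omega Lambda f.

(** Concave cones with slopes in [(B / 2, B)] and second derivative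
[- B N] are strict supersolutions. *)
Lemma barrier (osc w B N : R) : 0 < w -> 0 < N -> 0 < B ->
  (forall x y, K x -> K y -> f x - f y <= osc) ->
  4 * osc <= B * w -> 4 * osc * N <= B ->
  (forall x s, K x -> B / 2 < s < B -> enorm (Lambda x s) < B * N) ->
  exists2 r : R, 0 < r & forall a y, (forall y', enorm (y' - a) < 2 * w -> Omega y') ->
    enorm (y - a) <= r -> f y <= f a + B * enorm (y - a).
Proof.
move=> w0 N0 B0 Hosc H1 H2 HL.
pose r := Order.min w (1 / (2 * N)).
have r0 : 0 < r by rewrite lt_min w0 divr_gt0 // mulr_gt0.
have rw : r <= w by rewrite ge_min lexx.
have rN : 2 * (N * r) <= 1.
  by rewrite mulrA mulrC -ler_pdivlMr ?mulr_gt0 // ge_min lexx orbT.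
have BNr : 2 * (B * N * r) <= B.
  have : B * (2 * (N * r)) <= B * 1 by rewrite ler_pM2l.
  lra.
exists r => // a y Ha ya.
have BN0 : 0 < B * N by rewrite mulr_gt0.
pose kap := - (B * N).
have OK x : Omega x -> K x by exact: subset_closure.
pose A : set 'rV[R]_d := [set y | enorm (y - a) <= r].
have AO x : A x -> Omega x.
  rewrite /A /= => xa; apply: Ha; apply: le_lt_trans xa _.
  by apply: le_lt_trans rw _; rewrite mulr_natl mulr2n ltrDl.
have A0 : A !=set0 by exists a; rewrite /A /= subrr enorm0 ltW.
have cA : compact A by exact: compact_enorm_ball.
have cfA : {within A, continuous f}.
  by apply: continuous_subspaceW cf => x /AO/OK.
have cc : continuous (fun x => - bent_cone B kap (enorm (x - a))).
  apply: continuous_opp; apply: continuous_compose (@bent_cone_continuous _ _ _).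
  exact: distance_continuous.
have [y0 Ay0 mx] := max_one A0 cA cfA cc.
suff main : f y0 - bent_cone B kap (enorm (y0 - a)) <= f a.
  have := mx y ya; rewrite /bent_cone /kap in main *.
  have := mulr_ge0 (ltW BN0) (sqr_ge0 (enorm (y - a))).
  lra.
have Kya : K y0 by exact/OK/AO.
have Ka : K a by apply: OK; apply: Ha; rewrite subrr enorm0 mulr_gt0.
have [->|kz] := eqVneq y0 a.
  by rewrite subrr enorm0 /bent_cone mulr0 expr0n mulr0 addr0 subr0.
pose k := y0 - a; have k0 : k != 0 by rewrite subr_eq0.
have nk := enorm_gt0 k0.
have [kr|kr] := eqVneq (enorm k) r.
  rewrite -/k kr; have := Hosc _ _ Kya Ka.
  have : osc <= bent_cone B kap r.
    have BrN : B * N * r * r <= B / 2 * r by rewrite ler_pM2r //; lra.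
    have Br0 : 0 < B * r by rewrite mulr_gt0.
    have Br : 2 * osc <= B * r.
      rewrite /r; case: (leP w (1 / (2 * N))) => _.
        have : 0 < B * w by rewrite mulr_gt0.
        lra.
      rewrite mulrA mulr1 ler_pdivlMr ?mulr_gt0 //; lra.
    rewrite /bent_cone /kap; lra.
  lra.
have kltr : enorm k < r by rewrite lt_neqAle kr.
exfalso.
have contact : exists2 r : R, 0 < r & forall h, enorm h < r ->
    f (y0 + h) - f y0 <= bent_cone B kap (enorm (k + h)) - bent_cone B kap (enorm k).
  exists (r - enorm k); first by rewrite subr_gt0.
  move=> h hr; have := mx (y0 + h); rewrite /A /= addrAC => /(_ _).
  have : enorm (y0 - a + h) <= r.
    by apply: le_trans (enormD _ _) _; rewrite -lerBrDl ltW.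
  by move=> H /(_ H); rewrite -/k; lra.
have ck : B / 2 < B + kap * enorm k < B.
  have : B * N * enorm k < B * N * r by rewrite ltr_pM2l.
  have : 0 < B * N * enorm k by rewrite mulr_gt0.
  by rewrite /kap => *; apply/andP; split; lra.
have c0 : 0 < B + kap * enorm k by lra.
have [A1 [B1 [tf kapE]]] := radial_contact k0 (lt0r_neq0 c0) contact.
have Oy0 : Omega y0 by exact: AO.
set q := _ *: k in tf kapE.
have nq : enorm q = B + kap * enorm k.
  by rewrite enormZ gtr0_norm ?divr_gt0 // divfK ?gt_eqF.
have q0 : q != 0.
  by apply/eqP => qz; move: c0; rewrite -nq qz enorm0 ltxx.
have := Hf Oy0 tf q0; rewrite /normalized kapE.
have := drift_le y0 q; rewrite nq; have := HL y0 _ Kya ck.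
have := ler_norm (drift Lambda y0 q); rewrite /kap; lra.
Qed.

(** From [a] to [a - t q] the function drops by almost [t |q|^2]; the barrier
centred at [a - t q] allows a drop of at most [B t |q|]. *)
Lemma subsolution_slope_bound (osc w0 : R) : 0 < w0 -> 
  (forall x y, K x -> K y -> f x - f y <= osc) ->
  exists2 L : R, 0 < L & slope_bound Omega w0 L f.
Proof.
move=> w00 Hosc; pose o := `|osc| + 1.
have o0 : 0 < o by rewrite ltr_wpDl.
have oo : osc <= o by have := ler_norm osc; rewrite /o; lra.
have w4 : 0 < w0 / 4 by rewrite divr_gt0.
have T0 : 0 < 4 * o * (1 + 4 / w0).
  by rewrite mulr_gt0 ?mulr_gt0 // addr_gt0 // divr_gt0.
have [B [N [N0 TB TN HL]]] := Lambda_growth T0.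
have B0 : 0 < B by apply: lt_le_trans TB.
have w40 : 0 < 4 / w0 by rewrite divr_gt0.
have Hosc' x y : K x -> K y -> f x - f y <= o.
  by move=> Kx Ky; apply: le_trans (Hosc x y Kx Ky) oo.
have Hw : 4 * o <= B * (w0 / 4).
  have H : 4 * o * (4 / w0) <= B.
    by apply: le_trans TB; rewrite ler_pM2l ?mulr_gt0 // lerDr.
  have := ler_wpM2r (ltW w00) H.
  rewrite (_ : 4 * o * (4 / w0) * w0 = 16 * o); last by field; rewrite gt_eqF.
  lra.
have HN : 4 * o * N <= B.
  by apply: le_trans TN; rewrite ler_pM2r // ler_peMr ?mulr_ge0 ?(ltW o0) //; lra.
have [r r0 Hr] := barrier w4 N0 B0 Hosc' Hw HN HL.
exists B => // a q C Ha Hq; rewrite leNgt; apply/negP => qB.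
have nq : 0 < enorm q by apply: lt_trans qB.
pose D := 2 * (`|C| + 1) * enorm q.
have D0 : 0 < D by rewrite mulr_gt0 // mulr_gt0 // ltr_wpDl.
pose t := Order.min (Order.min r (w0 / 2) / (2 * enorm q)) ((enorm q - B) / D).
have t0 : 0 < t.
  by rewrite lt_min; apply/andP; split; apply: divr_gt0;
    rewrite ?subr_gt0 ?mulr_gt0 // lt_min r0 divr_gt0.
have tq : 2 * (t * enorm q) <= Order.min r (w0 / 2).
  by rewrite mulrCA -ler_pdivlMr ?mulr_gt0 // ge_min lexx.
have tD : t * D <= enorm q - B by rewrite -ler_pdivlMr // ge_min lexx orbT.
have tq0 : 0 < t * enorm q by rewrite mulr_gt0.
have [tr tw] : t * enorm q <= r /\ t * enorm q < w0 / 2.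
  by move: tq; rewrite le_min => /andP[]; split; lra.
pose x := a - t *: q.
have xaE : x - a = - (t *: q) by rewrite /x addrAC subrr add0r.
have xa : enorm (x - a) = t * enorm q by rewrite xaE enormN enormZ gtr0_norm.
have Kx : K x by apply: subset_closure; apply: Ha; rewrite xa; lra.
have := Hr x a; rewrite (enormB a x) xa => /(_ _ tr) H1.
have := Hq x Kx; rewrite xaE !dotE -sqr_enorm => H2.
have {}H1 : f a <= f x + B * (t * enorm q).
  apply: H1 => y' y'x; apply: Ha.
  apply: le_lt_trans (enormB_triangle x _ _) _; rewrite xa; lra.
have : t * enorm q * enorm q <= t * enorm q * (B + t * `|C| * enorm q).
  have : C * (t ^+ 2 * enorm q ^+ 2) <= `|C| * (t ^+ 2 * enorm q ^+ 2).
    by rewrite ler_wpM2r ?ler_norm // mulr_ge0 ?sqr_ge0.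
  lra.
rewrite ler_pM2l //; move: tD; rewrite /D => tD.
have : 0 <= t * `|C| * enorm q by rewrite !mulr_ge0 // ltW.
lra.
Qed.

End Slope.

(** * Comparison *)

Section Drift.
Variables (R : realType) (d : nat) (K : set 'rV[R]_d).
Variable Lambda : 'rV[R]_d -> R -> 'rV[R]_d.
Implicit Types (x p : 'rV[R]_d).

Hypothesis Lambda_cont : {within K `*` [set s : R | 0 < s],
  continuous (fun z : 'rV[R]_d * R => Lambda z.1 z.2)}.

Lemma direction_lipschitz p p' : p != 0 -> p' != 0 ->
  enorm ((enorm p')^-1 *: p' - (enorm p)^-1 *: p) <= 2 * enorm (p' - p) / enorm p.
Proof.
move=> p0 p'0; have np := enorm_gt0 p0; have np' := enorm_gt0 p'0.
have -> : (enorm p')^-1 *: p' - (enorm p)^-1 *: p = (enorm p)^-1 *: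
    ((p' - p) + ((enorm p - enorm p') / enorm p') *: p').
  by apply/rowP => i; rewrite !mxE; field; rewrite !gt_eqF.
rewrite enormZ gtr0_norm ?invr_gt0 // mulrC ler_pM2r ?invr_gt0 //.
apply: le_trans (enormD _ _) _; rewrite enormZ normrM normfV (gtr0_norm np').
by rewrite divfK ?gt_eqF // mulr_natl mulr2n lerD2l (enormB p') abs_enormB.
Qed.

Lemma drift_near x p (e : R) : K x -> p != 0 -> 0 < e ->
  exists2 r : R, 0 < r & forall x' p', K x' -> p' != 0 ->
    enorm (x' - x) < r -> enorm (p' - p) < r ->
    `|drift Lambda x' p' - drift Lambda x p| < e.
Proof.
move=> Kx p0 e0; have np := enorm_gt0 p0; have e2 : 0 < e / 2 by rewrite divr_gt0.
move/subspace_continuousP: Lambda_cont => /(_ (x, enorm p) (conj Kx np)) /=.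
set lam := Lambda x (enorm p) => cL.
have : nbhs lam [set y | enorm (y - lam) < e / 2].
  by apply/nbhs_enorm; exists (e / 2).
move=> /cL /= [[U W] /= [Ux Wp] UW].
have [r1 r10 Hr1] := (nbhs_enorm x U).1 Ux.
have [r2 r20 Hr2] : exists2 r : R, 0 < r & forall p', enorm (p' - p) < r -> W (enorm p').
  by apply/nbhs_enorm; exact: (@enorm_continuous R d p W Wp).
have l0 := enorm_ge0 lam.
have r30 : 0 < e / 2 * enorm p / (2 * (enorm lam + 1)).
  by rewrite divr_gt0 ?mulr_gt0 // ltr_wpDl.
exists (Order.min r1 (Order.min r2 (e / 2 * enorm p / (2 * (enorm lam + 1))))).
  by rewrite !lt_min r10 r20 r30.
move=> x' p' Kx' p'0; rewrite !lt_min => /and3P[xr1 _ _] /and3P[_ pr2 pr3].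
have np' := enorm_gt0 p'0.
have dl : enorm (Lambda x' (enorm p') - lam) < e / 2.
  by apply: (UW (x', enorm p')); split => //=; [exact: Hr1|exact: Hr2].
rewrite (_ : drift _ _ _ - _ =
  dot (Lambda x' (enorm p') - lam) ((enorm p')^-1 *: p') +
  dot lam ((enorm p')^-1 *: p' - (enorm p)^-1 *: p)); last first.
  by rewrite /drift -/lam !dotE; field; rewrite !gt_eqF.
apply: le_lt_trans (ler_normD _ _) _.
rewrite [ltRHS](_ : e = e / 2 + e / 2); last by field.
apply: ltr_leD.
  apply: le_lt_trans (ler_abs_dot _ _) _.
  by rewrite enormZ gtr0_norm ?invr_gt0 // mulVf ?gt_eqF // mulr1.
apply: le_trans (ler_abs_dot _ _) _.
apply: le_trans (_ : (enorm lam + 1) * (2 * enorm (p' - p) / enorm p) <= _).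
  by rewrite ler_pM ?enorm_ge0 // ?direction_lipschitz // lerDl.
move: pr3; rewrite ltr_pdivlMr ?mulr_gt0 ?ltr_wpDl // => pr3.
rewrite mulrA ler_pdivrMr //; apply: le_trans (ltW pr3).
by rewrite le_eqVlt; apply/orP; left; apply/eqP; ring.
Qed.

Hypothesis cK : compact K.

Lemma drift_uniform (m M e : R) : 0 < m -> 0 < e ->
  exists2 r : R, 0 < r & forall x x' p p', K x -> K x' ->
    m <= enorm p <= M -> m <= enorm p' <= M ->
    enorm (x - x') < r -> enorm (p - p') < r ->
    `|drift Lambda x p - drift Lambda x' p'| < e.
Proof.
move=> m0 e0.
pose A : set 'rV[R]_d := [set p | enorm (p - 0) <= M] `&` (@enorm R d) @^-1` [set t | m <= t].
have AE p : A p <-> m <= enorm p <= M.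
  rewrite /A /= subr0; split; first by move=> [-> ->].
  by move=> /andP[].
have cA : compact A.
  apply: compact_closedI; first exact: compact_enorm_ball.
  by apply: closed_comp; [move=> p _; exact: enorm_continuous|exact: closed_ge].
have nz p : A p -> p != 0.
  move=> /AE /andP[mp _]; apply/eqP => p0; move: mp; rewrite p0 enorm0.
  by rewrite leNgt m0.
pose P := fun (t : R) (z : 'rV[R]_d * 'rV[R]_d) => forall x' p', K x' -> A p' ->
  enorm (z.1 - x') < t -> enorm (z.2 - p') < t ->
  `|drift Lambda z.1 z.2 - drift Lambda x' p'| < e.
have [|r r0 Hr] := @uniform_scale R _ (K `*` A) P (compact_setX cK cA).
  move=> [x0 p0] [/= Kx0 Ap0].
  have e2 : 0 < e / 2 by rewrite divr_gt0.
  have [r r0 Hr] := drift_near Kx0 (nz _ Ap0) e2.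
  have r2 : 0 < r / 2 by rewrite divr_gt0.
  exists (r / 2) => //.
  exists ([set x | enorm (x - x0) < r / 2], [set p | enorm (p - p0) < r / 2]).
    by split; apply/nbhs_enorm; exists (r / 2).
  move=> [x p] [/= xr pr] [/= Kx Ap] t /andP[t0 tr] x' p' Kx' Ap' /= xt pt.
  have D1 := Hr x p Kx (nz _ Ap).
  have D2 := Hr x' p' Kx' (nz _ Ap').
  have rr : r / 2 < r by lra.
  have x'r : enorm (x' - x0) < r.
    apply: le_lt_trans (enormB_triangle x _ _) _; rewrite (enormB x').
    by lra.
  have p'r : enorm (p' - p0) < r.
    apply: le_lt_trans (enormB_triangle p _ _) _; rewrite (enormB p').
    by lra.
  have := D1 (lt_trans xr rr) (lt_trans pr rr); have := D2 x'r p'r.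
  by rewrite !ltr_norml => /andP[? ?] /andP[? ?]; apply/andP; split; lra.
exists r => // x x' p p' Kx Kx' Ap Ap' xr pr.
by apply: (Hr (x, p)) => //; [split => //=|]; apply/AE.
Qed.

End Drift.

Section Comparison.
Variables (R : realType) (d : nat) (Omega : set 'rV[R]_d).
Implicit Types (f V : 'rV[R]_d -> R) (x y p : 'rV[R]_d).

Let K := closure Omega.

Lemma bounded_closure_compact : bounded_set Omega -> compact K.
Proof.
move=> [M [_ /(_ (M + 1))]]; rewrite ltrDl ltr01 => /(_ isT) OM.
apply: bounded_closed_compact; last exact: closed_closure.
exists (M + 1); split; first exact: num_real.
move=> M' MM' x Kx; apply/ltW; apply: le_lt_trans MM'.
have : closed [set y : 'rV[R]_d | `|y| <= M + 1].
  rewrite (_ : [set _ | _] = (@Num.norm R 'rV[R]_d) @^-1` [set t | t <= M + 1]) //.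
  by apply: closed_comp; [move=> y _; exact: norm_continuous|exact: closed_le].
move=> /closure_id cE; suff : closure [set y : 'rV[R]_d | `|y| <= M + 1] x.
  by rewrite -cE.
exact: closure_subset Kx.
Qed.

Lemma frontier_compact : compact K -> compact (frontier Omega).
Proof.
move=> cK; rewrite /frontier setDE; apply: compact_closedI => //.
by apply: open_closedC; exact: open_interior.
Qed.

Lemma closure_frontier x : K x -> ~ frontier Omega x -> nbhs x Omega.
Proof.
by move=> Kx nF; apply: contrapT => nO; apply: nF; split.
Qed.

(** A point of the closure that maximises a coordinate is not interior. *)
Lemma frontier_nonempty : (0 < d)%N -> Omega !=set0 -> compact K ->
  frontier Omega !=set0.
Proof.
move=> d0 [x0 Ox0] cK; pose e : 'rV[R]_d := delta_mx 0 (Ordinal d0).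
have K0 : K !=set0 by exists x0; exact: subset_closure.
have c0 : {within K, continuous (fun=> 0 : R)}.
  by apply: continuous_subspaceT => y; exact: cst_continuous.
have [x Kx mx] := max_one K0 cK c0 (@affine_continuous R d e 0 0).
exists x; split => //= /nbhs_enorm [r r0 Hr].
have ee : dot e e = 1 by rewrite dot_delta mxE !eqxx.
have r2 : 0 < r / 2 by rewrite divr_gt0.
have Ox : Omega (x + (r / 2) *: e).
  apply: Hr; rewrite addrAC subrr add0r enormZ gtr0_norm //.
  by rewrite /enorm ee sqrtr1 mulr1 ltr_pdivrMr // ltr_pMr // ltr1n.
have := mx _ (subset_closure Ox); rewrite !subr0 !add0r !dotE ee mulr1.
by rewrite gerDl leNgt r2.
Qed.

Lemma compact_ub f : compact K -> {within K, continuous f} ->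
  exists2 M : R, 0 < M & forall x, K x -> `|f x| <= M.
Proof.
move=> cK cf; have [[x0 Kx0]|K0] := pselect (K !=set0); last first.
  by exists 1 => // x Kx; exfalso; apply: K0; exists x.
have [a Ka mxa] := max_one (ex_intro _ x0 Kx0) cK cf (@continuous_cst R _ 0).
have [|b Kb mxb] := max_one (ex_intro _ x0 Kx0) cK _ (@continuous_cst R _ 0)
  (f := fun x => - f x).
  by apply: (@continuous_opp R (subspace K)); exact: cf.
exists (`|f a| + `|f b| + 1).
  by rewrite ltr_wpDl // addr_ge0.
move=> x Kx; have := mxa x Kx; have := mxb x Kx.
have := ler_norm (f a); have := ler_norm (- f b); rewrite normrN !addr0.
have := normr_ge0 (f a); have := normr_ge0 (f b).
by rewrite ler_norml => *; apply/andP; split; lra.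
Qed.

(** Near the frontier the sum stays below [M0] by continuity, also when its
terms are evaluated at different nearby points. This keeps doubled maxima
inside [Omega] once their two points are close. *)
Lemma uniform_interior f V (m M0 : R) : compact K ->
  {within K, continuous f} -> {within K, continuous V} -> m < M0 ->
  (forall x, frontier Omega x -> f x + V x <= m) ->
  exists2 w : R, 0 < w & forall x y, K x -> K y -> enorm (x - y) < w ->
    M0 <= f x + V y -> forall y', enorm (y' - x) < w -> Omega y'.
Proof.
move=> cK cf cV mM HF.
pose P := fun (t : R) x => forall y, K y -> enorm (x - y) < t ->
    M0 <= f x + V y -> forall y', enorm (y' - x) < t -> Omega y'.
have [|w w0 Hw] := @uniform_scale R _ K P cK; last first.
  by exists w => // x y Kx Ky xy MxV; apply: (Hw x Kx y).
move=> x0 Kx0.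
have [Fx0|nF] := pselect (frontier Omega x0); last first.
  have [r r0 Hr] := (nbhs_enorm x0 _).1 (closure_frontier Kx0 nF).
  have r2 : 0 < r / 2 by rewrite divr_gt0.
  exists (r / 2) => //; apply/nbhs_enorm; exists (r / 2) => // x xr Kx t /andP[_ tr].
  move=> y _ _ _ y' y't; apply: Hr; apply: le_lt_trans (enormB_triangle x _ _) _.
  lra.
have e0 : 0 < (M0 - m) / 2 by rewrite divr_gt0 // subr_gt0.
have [r1 r10 H1] := (nbhs_enorm x0 _).1 (within_continuous_near cf Kx0 e0).
have [r2 r20 H2] := (nbhs_enorm x0 _).1 (within_continuous_near cV Kx0 e0).
have r0 : 0 < Order.min r1 r2 by rewrite lt_min r10.
have [ler1 ler2] : Order.min r1 r2 <= r1 /\ Order.min r1 r2 <= r2.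
  by rewrite !ge_min !lexx orbT.
move: (Order.min r1 r2) r0 ler1 ler2 => r r0 ler1 ler2.
have r2' : 0 < r / 2 by rewrite divr_gt0.
exists (r / 2) => //; apply/nbhs_enorm; exists (r / 2) => // x xr Kx t /andP[_ tr].
move=> y Ky xy MxV y' _; exfalso.
have xr1 : enorm (x - x0) < r1 by lra.
have yr2 : enorm (y - x0) < r2.
  apply: le_lt_trans (enormB_triangle x _ _) _; rewrite (enormB y); lra.
have := H1 _ xr1 Kx; have := H2 _ yr2 Ky; have := HF _ Fx0.
rewrite !ltr_norml => ? /andP[? ?] /andP[? ?]; lra.
Qed.

Variables (Lambda : 'rV[R]_d -> R -> 'rV[R]_d) (eps lambda : R).
Hypothesis d_gt0 : (0 < d)%N.
Hypotheses (O0 : Omega !=set0) (OB : bounded_set Omega).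
Hypothesis Lambda_cont : {within K `*` [set s : R | 0 < s],
  continuous (fun z : 'rV[R]_d * R => Lambda z.1 z.2)}.
Hypothesis Lambda_lim : forall e : R, 0 < e ->
  \forall s \near (0 : R)^'+, forall x, K x -> enorm (s ^+ 2 *: Lambda x s) < e.
Hypotheses (eps0 : 0 < eps) (lambda0 : 0 < lambda).
Hypothesis Theta_lip : forall (a : R) x (s : R), 1 < a < 2 -> K x -> 0 < s ->
  enorm ((a * s)^-1 *: Lambda x (a * s) - s^-1 *: Lambda x s) <= lambda * `|a - 1|.

Lemma steepen_continuous (eta : R) : continuous (steepen eps lambda eta).
Proof.
apply: continuous_add; first by move=> t; exact: cvg_id.
apply: continuous_mul; first exact: continuous_cst.
apply: continuous_compose (@continuous_expR R).
by apply: continuous_mul; [exact: continuous_cst|move=> t; exact: cvg_id].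
Qed.

(** Once [V] is replaced by a nearby strict subsolution, an interior excess of
[f + V] over its frontier values contradicts [doubling_contradiction]. *)
Lemma contact_comparison f V :
  {within K, continuous f} -> {within K, continuous V} ->
  subsolution_at_contact Omega Lambda f ->
  steep_subsolution_at_contact Omega Lambda eps V ->
  sup_le_max Omega (frontier Omega) (fun x => f x + V x).
Proof.
move=> cf cV Hf HV; have cK := bounded_closure_compact OB.
have F0 := frontier_nonempty d_gt0 O0 cK.
have FK : frontier Omega `<=` K by move=> x [].
have OK x : Omega x -> K x by exact: subset_closure.
have cfV : {within K, continuous (fun x => f x + V x)}.
  exact: (@continuous_add R (subspace K)).
have [xF FxF mxF] := max_one F0 (frontier_compact cK)
  (continuous_subspaceW FK cfV) (@continuous_cst R _ 0).
pose m := f xF + V xF.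
have Fm x : frontier Omega x -> f x + V x <= m.
  by move=> /mxF; rewrite !addr0.
exists m; first by split; [exists xF|move=> _ [x Fx <-]; exact: Fm].
apply: ge_ereal_sup => _ [x1 Ox1 <-]; rewrite lee_fin leNgt; apply/negP => m1.
have Kx1 := OK _ Ox1.
have [mf mf0 Hmf] := compact_ub cK cf.
have [mV mV0 HmV] := compact_ub cK cV.
pose gap := f x1 + V x1 - m; have gap0 : 0 < gap by rewrite subr_gt0.
pose k := (2 * lambda + 1) / eps.
have k0 : 0 < k by apply: divr_gt0 => //; rewrite addr_gt0 // mulr_gt0.
pose E := expR (k * mV); have E0 : 0 < E by exact: expR_gt0.
pose eta := Order.min (1 / (2 * E)) (gap * k / (2 * E)).
have E2 : 0 < 2 * E by rewrite mulr_gt0.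
have eta0 : 0 < eta.
  by rewrite lt_min; apply/andP; split; apply: divr_gt0 => //; exact: mulr_gt0.
have etaE : eta * (2 * E) <= 1 by rewrite -ler_pdivlMr // ge_min lexx.
have etagap : eta * (2 * E) <= gap * k by rewrite -ler_pdivlMr // ge_min lexx orbT.
have EV x : K x -> expR (- (k * mV)) <= expR (k * V x) <= E.
  move=> Kx; have := HmV x Kx; rewrite ler_norml => /andP[H1 H2].
  by rewrite !ler_expR -mulrN !ler_pM2l // H1 H2.
pose W := fun x => steepen eps lambda eta (V x).
have WV x : K x -> V x < W x <= V x + gap / 2.
  move=> Kx; have /andP[_ H] := EV x Kx.
  have ek : 0 < eta / k by exact: divr_gt0.
  apply/andP; split; first by rewrite /W /steepen ltrDl mulr_gt0 // expR_gt0.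
  rewrite /W /steepen -/k lerD2l; apply: (@le_trans _ _ (eta / k * E)).
    by rewrite ler_pM2l.
  by rewrite mulrAC ler_pdivrMr // mulrAC ler_pdivlMr // -mulrA (mulrC E).
have cW : {within K, continuous W}.
  exact: (@continuous_compose R (subspace K) V _ cV (@steepen_continuous eta)).
have strict x p A B : Omega x -> touches W x p A B ->
    eps <= enorm p /\ eps * eta * expR (- (k * mV)) <= normalized Lambda x p A B.
  apply: (@steepen_strict R d Omega Lambda eps lambda eta _ V eps0 lambda0 eta0
    Theta_lip HV).
    by move=> y /OK /EV /andP[].
  move=> y /OK /EV /andP[_ H].
  have : eta * expR (k * V y) <= eta * E by rewrite ler_pM2l.
  rewrite /k in H *; lra.
pose mu := eps * eta * expR (- (k * mV)).
have mu0 : 0 < mu by rewrite /mu; apply: mulr_gt0; [exact: mulr_gt0|exact: expR_gt0].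
pose M0 := f x1 + W x1.
have FM0 x : frontier Omega x -> f x + W x <= m + gap / 2.
  by move=> Fx; have := Fm x Fx; have /andP[_] := WV x (FK _ Fx); lra.
have mM0 : m + gap / 2 < M0.
  by rewrite /M0; have /andP[H _] := WV _ Kx1; rewrite /gap in gap0 *; lra.
have [w w0 Hw] := uniform_interior cK cf cW mM0 FM0.
have Hosc x y : K x -> K y -> f x - f y <= 2 * mf.
  move=> /Hmf + /Hmf; rewrite !ler_norml => /andP[? ?] /andP[? ?]; lra.
have [L L0 HL] := subsolution_slope_bound lambda0 Theta_lip Lambda_lim cf Hf w0 Hosc.
have eps20 : 0 < eps / 2 by rewrite divr_gt0.
have mu40 : 0 < mu / 4 by rewrite divr_gt0.
have [zeta zeta0 Hz] := drift_uniform Lambda_cont cK (L + 1) eps20 mu40.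
apply: (@doubling_contradiction R d Omega Lambda f W eps mu M0 (mf + mV + gap / 2 - M0)
  w L zeta cK cf cW) => //.
  by exists x1.
move=> x y Kx Ky; have /andP[_] := WV y Ky.
have := HmV y Ky; have := Hmf x Kx; rewrite !ler_norml => /andP[? ?] /andP[? ?].
lra.
Qed.

End Comparison.

Theorem theorem13 (R : realType) (d : nat) (Omega : set 'rV[R]_d)
    (Lambda : 'rV[R]_d -> R -> 'rV[R]_d) (eps : R)
    (d_gt0 : (0 < d)%N)
    (Omega_dom : bounded_smooth_domain Omega)
    (Lambda_cont : {within closure Omega `*` [set s : R | 0 < s],
                     continuous (fun z : 'rV[R]_d * R => Lambda z.1 z.2)})
    (Lambda_lim : forall e : R, 0 < e ->
       \forall s \near (0 : R)^'+, forall x, closure Omega x ->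
         enorm (s ^+ 2 *: Lambda x s) < e)
    (eps_gt0 : 0 < eps) (eps_lt1 : eps < 1)
    (Theta_lip : let Theta := fun x s => s^-1 *: Lambda x s in
       exists2 lambda : R, 0 < lambda &
         forall a x s, 1 < a < 2 -> closure Omega x -> 0 < s ->
           enorm (Theta x (a * s) - Theta x s) <= lambda * `|a - 1|) :
  (forall u v : 'rV[R]_d -> R,
     {within closure Omega, continuous u} -> W1infty Omega u ->
     {within closure Omega, continuous v} -> W1infty Omega v ->
     viscosity_subsolution Omega (neg_inf_laplacian Lambda) u ->
     viscosity_supersolution Omega (min_operator Lambda eps) v ->
     sup_le_max Omega (frontier Omega) (fun x => u x - v x)) /\
  (forall u v : 'rV[R]_d -> R,
     {within closure Omega, continuous u} -> W1infty Omega u ->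
     {within closure Omega, continuous v} -> W1infty Omega v ->
     viscosity_supersolution Omega (neg_inf_laplacian Lambda) u ->
     viscosity_subsolution Omega (max_operator Lambda eps) v ->
     sup_le_max Omega (frontier Omega) (fun x => v x - u x)).
Proof.
case: Omega_dom => _ _ O0 OB _; case: Theta_lip => lambda lambda0 TL.
have comparison := contact_comparison d_gt0 O0 OB Lambda_cont Lambda_lim eps_gt0 lambda0 TL.
have opp_cont (w : 'rV[R]_d -> R) : {within closure Omega, continuous w} ->
    {within closure Omega, continuous (fun x => - w x)}.
  by move=> cw; apply: (@continuous_opp R (subspace (closure Omega))).
split=> u v cu _ cv _ Hu Hv.
  apply: comparison => //; first exact: opp_cont.
    exact: subsolution_contact Hu.
  exact: min_supersolution_contact Hv.
(* the drift is odd, so [- u] and [v] are in the situation of [comparison] *)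
under eq_fun do rewrite addrC.
apply: comparison => //; first exact: opp_cont.
  exact: supersolution_contact Hu.
exact: max_subsolution_contact Hv.
Qed.
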